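(* Let $d\ge1$ be an integer, let $\mathcal{C}$ and $\mathcal{D}$ be triangulated categories with Serre functors $\nu$, and let $\pi:\mathcal{D}\to\mathcal{C}$ be a triangle functor which commutes with $\nu$ and preserves $d$-rigidity. Assume that $\mathcal{U}\in d\text{-}\mathrm{ctilt}\,\mathcal{D}$ satisfies $\pi(\mathcal{U})\in d\text{-}\mathrm{ctilt}\,\mathcal{C}$. (1) If $\pi(\mathcal{U})$ has an additive generator, then for each $\mathcal{V}\in d\text{-}\mathrm{ctilt}\,\mathcal{D}$, $\pi(\mathcal{V})\in d\text{-}\mathrm{ctilt}\,\mathcal{C}$ holds and $\pi(\mathcal{V})$ has an additive generator. (2) If $\pi(\mathcal{U})$ is locally bounded and has a $\nu_d$-additive generator, then for each $\mathcal{V}\in d\text{-}\mathrm{ctilt}\,\mathcal{D}$, $\pi(\mathcal{V})\in d\text{-}\mathrm{ctilt}\,\mathcal{C}$ holds and $\pi(\mathcal{V})$ is locally bounded and has a $\nu_d$-additive generator.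
   Context: Triangulated categories with Serre functor are $k$-linear ($k$ a field) and Hom-finite; a Serre functor is a $k$-linear autoequivalence $\nu$ with functorial isomorphisms $D\mathrm{Hom}(X,Y)\simeq\mathrm{Hom}(Y,\nu X)$. Put $\nu_d:=\nu\circ[-d]$. A full subcategory $\mathcal{U}$ of a triangulated category $\mathcal{C}$ is $d$-rigid if $\mathrm{Hom}(\mathcal{U},\mathcal{U}[i])=0$ for $1\le i\le d-1$; $\pi$ preserves $d$-rigidity if it sends $d$-rigid subcategories to $d$-rigid subcategories. $\mathcal{U}$ is $d$-cluster tilting if it is functorially finite and $\mathcal{U}=\{X\mid \mathrm{Hom}(\mathcal{U},X[i])=0,\ 1\le i\le d-1\}=\{X\mid \mathrm{Hom}(X,\mathcal{U}[i])=0,\ 1\le i\le d-1\}$; $d\text{-}\mathrm{ctilt}\,\mathcal{C}$ is the set of $d$-cluster tilting subcategories. For a subcategory $\mathcal{V}\subset\mathcal{D}$, $\pi(\mathcal{V})$ is taken up to additive equivalence, i.e. it stands for the additive closure $\mathrm{add}\,\pi(\mathcal{V})$ in $\mathcal{C}$. An object $U\in\mathcal{U}$ is an additive generator of $\mathcal{U}$ if $\mathcal{U}=\mathrm{add}\,U$, and a $\nu_d$-additive generator if $\mathcal{U}=\mathrm{add}\{\nu_d^i(U)\mid i\in\mathbb{Z}\}$. A $k$-linear Hom-finite Krull-Schmidt category $\mathcal{A}$ is locally bounded if for each $A\in\mathcal{A}$, $\sum_{B}(\dim\mathrm{Hom}_{\mathcal{A}}(B,A)+\dim\mathrm{Hom}_{\mathcal{A}}(A,B))<\infty$,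 where $B$ runs over isomorphism classes of indecomposable objects. *)

(* Defs.v *)
From HB Require Import structures.
From mathcomp Require Import all_boot all_order all_algebra.

Set Implicit Arguments.
Unset Strict Implicit.
Unset Printing Implicit Defensive.

Import GRing.Theory.
Local Open Scope ring_scope.

Declare Scope cat_scope.
Delimit Scope cat_scope with cat.

(* Hom-finiteness is built in: a [vectType] is a finite-dimensional space. *)
Record linCat (k : fieldType) := LinCat {
  obj :> Type;
  mor : obj -> obj -> vectType k;
  idmor : forall X, mor X X;
  mcomp : forall X Y Z, mor Y Z -> mor X Y -> mor X Z;
  mcomp1m : forall X Y (f : mor X Y), mcomp (idmor Y) f = f;
  mcompm1 : forall X Y (f : mor X Y), mcomp f (idmor X) = f;
  mcompA : forall X Y Z W (h : mor Z W) (g : mor Y Z) (f : mor X Y),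
    mcomp h (mcomp g f) = mcomp (mcomp h g) f;
  mcomp_linl : forall X Y Z (a : k) (g g' : mor Y Z) (f : mor X Y),
    mcomp (a *: g + g') f = a *: mcomp g f + mcomp g' f;
  mcomp_linr : forall X Y Z (g : mor Y Z) (a : k) (f f' : mor X Y),
    mcomp g (a *: f + f') = a *: mcomp g f + mcomp g f'
}.

Arguments idmor {k l} X.
Arguments mcomp {k l X Y Z} g f.

Notation "g \oc f" := (mcomp g f)
  (at level 40, left associativity) : cat_scope.
Local Open Scope cat_scope.

Section Categories.
Variables (k : fieldType) (C : linCat k).
Implicit Types X Y Z : C.

Definition precomp X Y Z (f : mor X Y) (g : mor Y Z) : mor X Z := g \oc f.
Definition postcomp X Y Z (g : mor Y Z) (f : mor X Y) : mor X Z := g \oc f.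

Fact precomp_is_linear X Y Z (f : mor X Y) : linear (@precomp X Y Z f).
Proof. by move=> a g g'; apply: mcomp_linl. Qed.
HB.instance Definition _ X Y Z (f : mor X Y) :=
  GRing.isLinear.Build k (mor Y Z) (mor X Z) *:%R (@precomp X Y Z f)
    (@precomp_is_linear X Y Z f).

Fact postcomp_is_linear X Y Z (g : mor Y Z) : linear (@postcomp X Y Z g).
Proof. by move=> a f f'; apply: mcomp_linr. Qed.
HB.instance Definition _ X Y Z (g : mor Y Z) :=
  GRing.isLinear.Build k (mor X Y) (mor X Z) *:%R (@postcomp X Y Z g)
    (@postcomp_is_linear X Y Z g).

Definition is_iso X Y (f : mor X Y) : Prop :=
  exists g : mor Y X, g \oc f = idmor X /\ f \oc g = idmor Y.

Definition isomorphic X Y : Prop := exists f : mor X Y, is_iso f.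

Definition is_zero Z : Prop :=
  forall X, (forall f : mor X Z, f = 0) /\ (forall f : mor Z X, f = 0).

Definition is_dsum n (F : 'I_n -> C) Y : Prop :=
  exists (inj : forall i, mor (F i) Y) (proj : forall i, mor Y (F i)),
    [/\ forall i, proj i \oc inj i = idmor (F i),
        forall i j, i != j -> proj j \oc inj i = 0
      & \sum_(i < n) inj i \oc proj i = idmor Y].

Definition is_dsum2 X1 X2 Y : Prop :=
  exists (i1 : mor X1 Y) (i2 : mor X2 Y) (p1 : mor Y X1) (p2 : mor Y X2),
    [/\ p1 \oc i1 = idmor X1, p2 \oc i2 = idmor X2,
        p2 \oc i1 = 0, p1 \oc i2 = 0
      & i1 \oc p1 + i2 \oc p2 = idmor Y].

Definition is_summand X Y : Prop := exists X', is_dsum2 X X' Y.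

(* Full subcategories are predicates on objects. *)
Definition addcl (P : C -> Prop) X : Prop :=
  exists n (F : 'I_n -> C) Y,
    [/\ forall i, P (F i), is_dsum F Y & is_summand X Y].

Definition right_approx (P : C -> Prop) X U (f : mor U X) : Prop :=
  P U /\ forall U' (g : mor U' X), P U' -> exists h : mor U' U, g = f \oc h.

Definition left_approx (P : C -> Prop) X U (f : mor X U) : Prop :=
  P U /\ forall U' (g : mor X U'), P U' -> exists h : mor U U', g = h \oc f.

Definition functorially_finite (P : C -> Prop) : Prop :=
  (forall X, exists U (f : mor U X), right_approx P f) /\
  (forall X, exists U (f : mor X U), left_approx P f).

Definition indecomposable_in (P : C -> Prop) X : Prop :=
  [/\ P X, ~ is_zero X
    & forall Y Z, P Y -> P Z -> is_dsum2 Y Z X -> is_zero Y \/ is_zero Z].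

Definition local_end X : Prop :=
  idmor X <> 0 /\ forall f : mor X X, is_iso f \/ is_iso (idmor X - f).

Definition krull_schmidt (P : C -> Prop) : Prop :=
  forall X, P X -> exists n (F : 'I_n -> C),
    (forall i, P (F i) /\ local_end (F i)) /\ is_dsum F X.

(* The sum over isomorphism classes of indecomposables is finite iff its
   partial sums over finite families of pairwise non-isomorphic
   indecomposables are bounded. *)
Definition locally_bounded (P : C -> Prop) : Prop :=
  krull_schmidt P /\
  forall A, P A -> exists N : nat,
    forall n (B : 'I_n -> C),
      (forall i, indecomposable_in P (B i)) ->
      (forall i j, i != j -> ~ isomorphic (B i) (B j)) ->
      (\sum_(i < n) (\dim {: mor (B i) A} + \dim {: mor A (B i)}) <= N)%N.

Definition has_additive_generator (P : C -> Prop) : Prop :=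
  exists U, P U /\ forall X, P X <-> addcl (fun Y => Y = U) X.

End Categories.

Record functor (k : fieldType) (C D : linCat k) := Functor {
  fobj :> C -> D;
  fmap : forall X Y, mor X Y -> mor (fobj X) (fobj Y);
  fmap1 : forall X, fmap (idmor X) = idmor (fobj X);
  fmapM : forall X Y Z (g : mor Y Z) (f : mor X Y),
    fmap (g \oc f) = fmap g \oc fmap f
}.

Arguments fmap {k C D} F {X Y} f : rename.

Section Functors.
Variables (k : fieldType).
Implicit Types C D : linCat k.

Definition idF C : functor C C :=
  @Functor k C C id (fun _ _ f => f) (fun _ => erefl) (fun _ _ _ _ _ => erefl).

Fact compF1 C D E (G : functor D E) (F : functor C D) (X : C) :
  fmap G (fmap F (idmor X)) = idmor (G (F X)).
Proof. by rewrite !fmap1. Qed.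

Fact compFM C D E (G : functor D E) (F : functor C D) (X Y Z : C)
    (g : mor Y Z) (f : mor X Y) :
  fmap G (fmap F (g \oc f)) = fmap G (fmap F g) \oc fmap G (fmap F f).
Proof. by rewrite !fmapM. Qed.

Definition compF C D E (G : functor D E) (F : functor C D) : functor C E :=
  @Functor k C E (fun X => G (F X)) (fun _ _ f => fmap G (fmap F f))
    (compF1 G F) (@compFM C D E G F).

Definition additive_functor C D (F : functor C D) : Prop :=
  forall (X Y : C) (f g : mor X Y), fmap F (f + g) = fmap F f + fmap F g.

Definition linear_functor C D (F : functor C D) : Prop :=
  forall (X Y : C) (a : k) (f g : mor X Y),
    fmap F (a *: f + g) = a *: fmap F f + fmap F g.

Definition natural_iso C D (F G : functor C D)
    (phi : forall X : C, mor (F X) (G X)) : Prop :=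
  (forall X Y (f : mor X Y), phi Y \oc fmap F f = fmap G f \oc phi X) /\
  (forall X, is_iso (phi X)).

Definition naturally_isomorphic C D (F G : functor C D) : Prop :=
  exists phi : forall X : C, mor (F X) (G X), natural_iso phi.

End Functors.

(* The quasi-inverse is chosen data: it provides X[-n] and negative powers
   of Serre functors. *)
Record autoeq (k : fieldType) (C : linCat k) := Autoeq {
  fwd :> functor C C;
  bwd : functor C C;
  fwd_linear : linear_functor fwd;
  bwd_fwd : naturally_isomorphic (compF bwd fwd) (idF C);
  fwd_bwd : naturally_isomorphic (compF fwd bwd) (idF C)
}.

Record triCat (k : fieldType) := TriCat {
  tcat :> linCat k;
  has_zero : exists Z : tcat, is_zero Z;
  has_dsum2 : forall X Y : tcat, exists S, is_dsum2 X Y S;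
  shift : autoeq tcat;
  dist : forall X Y Z : tcat, mor X Y -> mor Y Z -> mor Z (shift X) -> Prop;
  TR1_iso : forall (X Y Z X' Y' Z' : tcat)
      (f : mor X Y) (g : mor Y Z) (h : mor Z (shift X))
      (f' : mor X' Y') (g' : mor Y' Z') (h' : mor Z' (shift X'))
      (a : mor X X') (b : mor Y Y') (c : mor Z Z'),
    is_iso a -> is_iso b -> is_iso c ->
    b \oc f = f' \oc a -> c \oc g = g' \oc b ->
    fmap shift a \oc h = h' \oc c ->
    dist f g h -> dist f' g' h';
  TR1_id : forall X Z : tcat, is_zero Z ->
    dist (idmor X) (0 : mor X Z) (0 : mor Z (shift X));
  TR1_cone : forall (X Y : tcat) (f : mor X Y),
    exists Z (g : mor Y Z) (h : mor Z (shift X)), dist f g h;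
  TR2 : forall (X Y Z : tcat) (f : mor X Y) (g : mor Y Z)
      (h : mor Z (shift X)),
    dist f g h <-> dist g h (- fmap shift f);
  TR3 : forall (X Y Z X' Y' Z' : tcat)
      (f : mor X Y) (g : mor Y Z) (h : mor Z (shift X))
      (f' : mor X' Y') (g' : mor Y' Z') (h' : mor Z' (shift X'))
      (a : mor X X') (b : mor Y Y'),
    dist f g h -> dist f' g' h' -> b \oc f = f' \oc a ->
    exists c : mor Z Z',
      c \oc g = g' \oc b /\ fmap shift a \oc h = h' \oc c;
  TR4 : forall (X Y Z A B E : tcat) (f : mor X Y) (g : mor Y Z)
      (f1 : mor Y A) (f2 : mor A (shift X))
      (g1 : mor Z B) (g2 : mor B (shift Y))
      (h1 : mor Z E) (h2 : mor E (shift X)),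
    dist f f1 f2 -> dist g g1 g2 -> dist (g \oc f) h1 h2 ->
    exists (u : mor A E) (v : mor E B),
      [/\ dist u v (fmap shift f1 \oc g2),
          u \oc f1 = h1 \oc g, h2 \oc u = f2,
          v \oc h1 = g1 & g2 \oc v = fmap shift f \oc h2]
}.

Arguments shift {k} t.
Arguments dist {k t X Y Z} f g h.

Section Serre.
Variables (k : fieldType) (C : linCat k).

Definition serre_duality (nu : functor C C)
    (eta : forall X Y : C, 'Hom(mor X Y, k^o) -> mor Y (nu X)) : Prop :=
  [/\ forall X Y, linear (eta X Y),
      forall X Y, bijective (eta X Y),
      forall (X X' Y : C) (f : mor X X') (phi : 'Hom(mor X Y, k^o)),
        eta X' Y (phi \o linfun (@precomp k C X X' Y f))%VF =
        fmap nu f \oc eta X Y phi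
    & forall (X Y Y' : C) (g : mor Y' Y) (phi : 'Hom(mor X Y, k^o)),
        eta X Y' (phi \o linfun (@postcomp k C X Y' Y g))%VF =
        eta X Y phi \oc g].

Record serreFunctor := SerreFunctor {
  serre :> autoeq C;
  serreP : exists eta, @serre_duality serre eta
}.

End Serre.

Section Triangulated.
Variables (k : fieldType) (C : triCat k).
Implicit Types X Y : C.

Definition shiftn (n : nat) X : C := iter n (shift C) X.
Definition unshiftn (n : nat) X : C := iter n (bwd (shift C)) X.

Definition rigid (d : nat) (P : C -> Prop) : Prop :=
  forall X Y, P X -> P Y ->
  forall i : nat, (1 <= i < d)%N -> forall f : mor X (shiftn i Y), f = 0.

Definition ctilt (d : nat) (P : C -> Prop) : Prop :=
  [/\ functorially_finite P,
      forall X, P X <->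
        (forall U, P U -> forall i : nat, (1 <= i < d)%N ->
           forall f : mor U (shiftn i X), f = 0)
    & forall X, P X <->
        (forall U, P U -> forall i : nat, (1 <= i < d)%N ->
           forall f : mor X (shiftn i U), f = 0)].

Variable nu : serreFunctor C.

Definition nud (d : nat) X : C := nu (unshiftn d X).
Definition nud_inv (d : nat) X : C := shiftn d (bwd nu X).
Definition nud_pow (d : nat) (i : int) X : C :=
  match i with
  | Posz n => iter n (nud d) X
  | Negz n => iter n.+1 (nud_inv d) X
  end.

Definition has_nud_additive_generator (d : nat) (P : C -> Prop) : Prop :=
  exists U, P U /\
    forall X, P X <-> addcl (fun Y => exists i : int, Y = nud_pow d i U) X.

End Triangulated.

Section TriangleFunctors.
Variables (k : fieldType) (D C : triCat k).

Definition triangle_functor (F : functor D C) : Prop :=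
  additive_functor F /\
  exists phi : forall X : D, mor (F (shift D X)) (shift C (F X)),
    natural_iso (F := compF F (shift D)) (G := compF (shift C) F) phi /\
    forall (X Y Z : D) (f : mor X Y) (g : mor Y Z) (h : mor Z (shift D X)),
      dist f g h -> dist (fmap F f) (fmap F g) (phi X \oc fmap F h).

Definition commutes_with_serre (nuD : serreFunctor D) (nuC : serreFunctor C)
    (F : functor D C) : Prop :=
  naturally_isomorphic (compF F nuD) (compF nuC F).

(* For V a full subcategory, pi(V) always stands for add pi(V). *)
Definition image_add (F : functor D C) (P : D -> Prop) : C -> Prop :=
  addcl (fun Y => exists X, P X /\ Y = F X).

Definition preserves_rigidity (d : nat) (F : functor D C) : Prop :=
  forall P : D -> Prop, rigid d P -> rigid d (image_add F P).

End TriangleFunctors.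

(* Main.v *)
Require Import Defs.
From HB Require Import structures.
From mathcomp Require Import all_boot all_order all_algebra.
From Stdlib Require Import Classical.
From Stdlib Require List.

Set Implicit Arguments.
Unset Strict Implicit.
Unset Printing Implicit Defensive.

Import Order.TTheory GRing.Theory Num.Theory.
Local Open Scope ring_scope.
Local Open Scope cat_scope.

(** Write [P] for the additive closure of [pi U] and [Q] for that of [pi V].

    The heart of the matter is that [Q] satisfies the two orthogonality
    conditions. It is rigid because [pi] preserves rigidity. It is stable under
    [nu_d] because [V] is, so Serre duality turns vanishing of the [Hom(Q, X[i])]
    into vanishing of the [Hom(X, Q[i])] ([image_perp_sym]). Objects of [U] have
    finite coresolutions by [V]; applying [pi], each object of [P] is controlled
    by a single object [W] of [Q], in the sense that maps from it to an object
    [Y] with all [Hom(W, Y[i])] zero factor through [add W] ([image_cogen]). On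
    the other hand each object [X] of [C] is filtered by [P], [P[1]], ...,
    [P[d-1]]. If [X] is orthogonal to [Q], approximate [X] by [add W], then the
    fibre of this approximation, and so on: the composite of the [d] connecting
    maps kills the [d] layers of [X], hence is zero, and since [X] is left
    orthogonal to [W] already the first connecting map is zero
    ([ghost_vanish]). So [X] lies in [add W] ([add_of_perp]).

    The same argument produces generators: [Q] is the additive closure of any
    family of its objects that controls [P] ([image_generated]). If [P = add M],
    one object controlling [M] is enough. Control is a statement about Hom
    spaces and shifts only, so it is transported by [nu_d] without knowing
    that [nu_d] is exact ([cogen_transport]); if [P] is the additive closure of
    the orbit of [M], then [Q] is the additive closure of the orbit of [W].

    What remains are finiteness questions. With an additive generator,
    approximations exist by Hom-finiteness. In the locally bounded case
    idempotents split in [P], hence along triangles in all of [C]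
    ([karoubi_cone]), so that [C] has decompositions into local objects. By
    local boundedness a local object of [P] is either periodic under [nu_d], or
    transient: each object has nonzero maps to and from only finitely many
    members of its orbit. Periodic and transient objects are orthogonal, so the
    filtration of an object [X] splits into a part filtered by periodic objects
    and a transient summand ([rfilt_splits_off]). Therefore a local object [T]
    of [Q] is transient, or a summand of an object filtered by periodic objects
    of [P]; the latter are controlled by all translates of some [W] under a power
    of [nu_d], so all translates of [T] lie in [add W] and [T] is periodic
    ([V_local_dichotomy]). As [Q] is generated by finitely many orbits of local
    objects, only finitely many local objects of [Q] have nonzero maps to or
    from a given object of [C], which gives both approximations and local
    boundedness. *)

Section Linear.
Variables (k : fieldType) (C : linCat k).
Implicit Types X Y Z W A B S : C.

Lemma compDl X Y Z (g g' : mor Y Z) (f : mor X Y) :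
  (g + g') \oc f = g \oc f + g' \oc f.
Proof. exact: (linearD (@precomp k C X Y Z f)). Qed.

Lemma compDr X Y Z (g : mor Y Z) (f f' : mor X Y) :
  g \oc (f + f') = g \oc f + g \oc f'.
Proof. exact: (linearD (@postcomp k C X Y Z g)). Qed.

Lemma compNl X Y Z (g : mor Y Z) (f : mor X Y) : (- g) \oc f = - (g \oc f).
Proof. exact: (linearN (@precomp k C X Y Z f)). Qed.

Lemma compNr X Y Z (g : mor Y Z) (f : mor X Y) : g \oc (- f) = - (g \oc f).
Proof. exact: (linearN (@postcomp k C X Y Z g)). Qed.

Lemma compBl X Y Z (g g' : mor Y Z) (f : mor X Y) :
  (g - g') \oc f = g \oc f - g' \oc f.
Proof. by rewrite compDl compNl. Qed.

Lemma compBr X Y Z (g : mor Y Z) (f f' : mor X Y) :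
  g \oc (f - f') = g \oc f - g \oc f'.
Proof. by rewrite compDr compNr. Qed.

Lemma comp0l X Y Z (f : mor X Y) : (0 : mor Y Z) \oc f = 0.
Proof. exact: (linear0 (@precomp k C X Y Z f)). Qed.

Lemma comp0r X Y Z (g : mor Y Z) : g \oc (0 : mor X Y) = 0.
Proof. exact: (linear0 (@postcomp k C X Y Z g)). Qed.

Lemma compZl X Y Z a (g : mor Y Z) (f : mor X Y) :
  (a *: g) \oc f = a *: (g \oc f).
Proof. exact: (linearZ_LR (@precomp k C X Y Z f)). Qed.

Lemma compZr X Y Z a (g : mor Y Z) (f : mor X Y) :
  g \oc (a *: f) = a *: (g \oc f).
Proof. exact: (linearZ_LR (@postcomp k C X Y Z g)). Qed.

Lemma comp_suml X Y Z I (r : seq I) (P : pred I) (G : I -> mor Y Z)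
    (f : mor X Y) :
  (\sum_(i <- r | P i) G i) \oc f = \sum_(i <- r | P i) (G i \oc f).
Proof. exact: (linear_sum (@precomp k C X Y Z f)). Qed.

Lemma comp_sumr X Y Z I (r : seq I) (P : pred I) (g : mor Y Z)
    (F : I -> mor X Y) :
  g \oc (\sum_(i <- r | P i) F i) = \sum_(i <- r | P i) (g \oc F i).
Proof. exact: (linear_sum (@postcomp k C X Y Z g)). Qed.

Lemma is_zeroP Z : is_zero Z <-> idmor Z = 0.
Proof.
split=> [z|z X]; first by case: (z Z).
by split=> f; [rewrite -(mcomp1m f) z comp0l | rewrite -(mcompm1 f) z comp0r].
Qed.

Definition orth X Y := forall f : mor X Y, f = 0.

Definition retract X Y := exists (s : mor X Y) (r : mor Y X), r \oc s = idmor X.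

Lemma iso_id X : is_iso (idmor X).
Proof. by exists (idmor X); rewrite mcomp1m. Qed.

Lemma iso_comp X Y Z (g : mor Y Z) (f : mor X Y) :
  is_iso g -> is_iso f -> is_iso (g \oc f).
Proof.
move=> [g' [g1 g2]] [f' [f1 f2]]; exists (f' \oc g'); split.
  by rewrite mcompA -(mcompA f') g1 mcompm1.
by rewrite mcompA -(mcompA g) f2 mcompm1.
Qed.

Lemma isomorphic_refl X : isomorphic X X.
Proof. by exists (idmor X); apply: iso_id. Qed.

Lemma isomorphic_sym X Y : isomorphic X Y -> isomorphic Y X.
Proof. by case=> f [g [gf fg]]; exists g, f. Qed.

Lemma isomorphic_trans Y X Z : isomorphic X Y -> isomorphic Y Z -> isomorphic X Z.
Proof. by move=> [f f_iso] [g g_iso]; exists (g \oc f); apply: iso_comp. Qed.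

Lemma isomorphic_retract X Y : isomorphic X Y -> retract X Y.
Proof. by case=> f [g [gf _]]; exists f, g. Qed.

Lemma retract_refl X : retract X X.
Proof. exact/isomorphic_retract/isomorphic_refl. Qed.

Lemma retract_trans Y X Z : retract X Y -> retract Y Z -> retract X Z.
Proof.
move=> [s [r rs]] [s' [r' rs']]; exists (s' \oc s), (r \oc r').
by rewrite mcompA -(mcompA r) rs' mcompm1.
Qed.

Lemma summand_retract X Y : is_summand X Y -> retract X Y.
Proof. by case=> X' [i1 [_ [p1 [_ [pi _ _ _ _]]]]]; exists i1, p1. Qed.

Lemma dsum2_retractl A B S : is_dsum2 A B S -> retract A S.
Proof. by move=> ABS; apply: summand_retract; exists B. Qed.

Lemma dsum2_sym A B S : is_dsum2 A B S -> is_dsum2 B A S.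
Proof.
move=> [i1 [i2 [p1 [p2 [h1 h2 h3 h4 h5]]]]].
by exists i2, i1, p2, p1; split; rewrite // addrC.
Qed.

Lemma dsum2_retractr A B S : is_dsum2 A B S -> retract B S.
Proof. by move/dsum2_sym; apply: dsum2_retractl. Qed.

Lemma orth_retract X X' Y Y' :
  retract X X' -> retract Y Y' -> orth X' Y' -> orth X Y.
Proof.
move=> [s [r rs]] [s' [r' rs']] o f.
have: s' \oc f \oc r = 0 by apply: o.
move/(congr1 (fun h => r' \oc h \oc s)).
by rewrite !mcompA rs' mcomp1m -mcompA rs mcompm1 comp0r comp0l.
Qed.

Lemma orth_isol X X' Y : isomorphic X X' -> orth X Y <-> orth X' Y.
Proof.
move=> e; split; apply: orth_retract; try exact: retract_refl.
  exact/isomorphic_retract/isomorphic_sym.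
exact: isomorphic_retract.
Qed.

Lemma orth_isor X Y Y' : isomorphic Y Y' -> orth X Y <-> orth X Y'.
Proof.
move=> e; split; apply: orth_retract; try exact: retract_refl.
  exact/isomorphic_retract/isomorphic_sym.
exact: isomorphic_retract.
Qed.

Lemma orth_dsum2l A B S Y : is_dsum2 A B S -> orth A Y -> orth B Y -> orth S Y.
Proof.
move=> [i1 [i2 [p1 [p2 [_ _ _ _ e]]]]] oA oB f.
rewrite -(mcompm1 f) -e compDr !mcompA.
by rewrite (oA (f \oc i1)) (oB (f \oc i2)) !comp0l addr0.
Qed.

Lemma orth_dsum2r A B S X : is_dsum2 A B S -> orth X A -> orth X B -> orth X S.
Proof.
move=> [i1 [i2 [p1 [p2 [_ _ _ _ e]]]]] oA oB f.
rewrite -(mcomp1m f) -e compDl -!mcompA.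
by rewrite (oA (p1 \oc f)) (oB (p2 \oc f)) !comp0r addr0.
Qed.

Lemma orth0l Z X : is_zero Z -> orth Z X.
Proof. by move=> z f; case: (z X) => _; apply. Qed.

Lemma orth0r Z X : is_zero Z -> orth X Z.
Proof. by move=> z f; case: (z X) => + _; apply. Qed.

Lemma iso_factor_retract X Y (a : mor X Y) (b : mor Y X) :
  is_iso (b \oc a) -> retract X Y.
Proof. by case=> c [e _]; exists a, (c \oc b); rewrite -mcompA. Qed.

Lemma local_idem X (e : mor X X) :
  local_end X -> e \oc e = e -> e = idmor X \/ e = 0.
Proof.
move=> [_ loc] ee; case: (loc e) => -[g [ge eg]].
  by left; rewrite -ge -{2}ee mcompA ge mcomp1m.
right; have e0 : (idmor X - e) \oc e = 0 by rewrite compBl mcomp1m ee subrr.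
by rewrite -(mcomp1m e) -ge -mcompA e0 comp0r.
Qed.

Lemma local_retract_iso X Y :
  local_end X -> local_end Y -> retract X Y -> isomorphic X Y.
Proof.
move=> lX lY [s [r rs]]; exists s, r; split=> //.
have ee : (s \oc r) \oc (s \oc r) = s \oc r.
  by rewrite mcompA -(mcompA s) rs mcompm1.
case: (local_idem lY ee) => // e0; case: lX => + _; case.
have <- : r \oc (s \oc r) \oc s = idmor X by rewrite mcompA rs mcomp1m rs.
by rewrite e0 comp0r comp0l.
Qed.

Lemma local_indec (P : C -> Prop) X : local_end X -> P X -> indecomposable_in P X.
Proof.
move=> lX PX; split=> // [/is_zeroP|A B _ _]; first by case: lX.
move=> [i1 [i2 [p1 [p2 [e1 e2 e3 e4 e]]]]].
have ee : (i1 \oc p1) \oc (i1 \oc p1) = i1 \oc p1.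
  by rewrite mcompA -(mcompA i1) e1 mcompm1.
case: (local_idem lX ee) => h; [right|left]; apply/is_zeroP.
  rewrite -e2 -(mcompm1 p2) -h mcompA e3 comp0l comp0l //.
by rewrite -e1 -(mcomp1m i1) -e h add0r -mcompA e3 comp0r comp0r.
Qed.

End Linear.

(** * Functors and autoequivalences *)

Section Functors.
Variables (k : fieldType) (C D : linCat k).

Lemma functor_iso (F : functor C D) (X Y : C) (f : mor X Y) :
  is_iso f -> is_iso (fmap F f).
Proof. by case=> g [gf fg]; exists (fmap F g); rewrite -!fmapM gf fg !fmap1. Qed.

Lemma functor_isomorphic (F : functor C D) (X Y : C) :
  isomorphic X Y -> isomorphic (F X) (F Y).
Proof. by case=> f fi; exists (fmap F f); apply: functor_iso. Qed.

Lemma functor_retract (F : functor C D) (X Y : C) :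
  retract X Y -> retract (F X) (F Y).
Proof. by case=> s [r rs]; exists (fmap F s), (fmap F r); rewrite -fmapM rs fmap1. Qed.

Lemma natiso_isomorphic (F G : functor C D) X :
  naturally_isomorphic F G -> isomorphic (F X) (G X).
Proof. by case=> phi [_ iso]; exists (phi X). Qed.

Lemma additive_functor0 (F : functor C D) X Y :
  additive_functor F -> fmap F (0 : mor X Y) = 0.
Proof. by move=> add; apply: (addrI (fmap F 0)); rewrite -add !addr0. Qed.

Lemma functor_dsum2 (F : functor C D) (A B S : C) :
  additive_functor F -> is_dsum2 A B S -> is_dsum2 (F A) (F B) (F S).
Proof.
move=> add [i1 [i2 [p1 [p2 [e1 e2 e3 e4 e]]]]].
exists (fmap F i1), (fmap F i2), (fmap F p1), (fmap F p2).
by rewrite -!fmapM -add e1 e2 e3 e4 e !fmap1 !additive_functor0.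
Qed.

Lemma linear_additive (F : functor C D) : linear_functor F -> additive_functor F.
Proof. by move=> lin X Y f g; have := lin X Y 1 f g; rewrite !scale1r. Qed.

End Functors.

Section Autoequivalence.
Variables (k : fieldType) (C : linCat k).

Lemma qinvE (F G : functor C C) : naturally_isomorphic (compF G F) (idF C) ->
  exists phi : forall X : C, mor (G (F X)) X,
    (forall (X Y : C) (f : mor X Y),
       phi Y \oc fmap G (fmap F f) = f \oc phi X) /\
    forall X, exists psi : mor X (G (F X)),
      psi \oc phi X = idmor (G (F X)) /\ phi X \oc psi = idmor X.
Proof. by case=> phi [nat iso]; exists phi. Qed.

Lemma qinv_faithful (F G : functor C C) :
  naturally_isomorphic (compF G F) (idF C) ->
  forall (X Y : C) (f g : mor X Y), fmap F f = fmap F g -> f = g.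
Proof.
case/qinvE=> phi [nat iso] X Y f g /(congr1 (fun h => phi Y \oc fmap G h)).
rewrite !nat; case: (iso X) => u [_ uv] /(congr1 (fun h => h \oc u)).
by rewrite -!mcompA uv !mcompm1.
Qed.

Lemma qinv_full (F G : functor C C) :
  naturally_isomorphic (compF G F) (idF C) ->
  naturally_isomorphic (compF F G) (idF C) ->
  forall (X Y : C) (h : mor (F X) (F Y)), exists f : mor X Y, fmap F f = h.
Proof.
case/qinvE=> phi [nat iso] FG X Y h.
case: (iso X) => u [uphi _]; case: (iso Y) => v [vphi _].
pose f : mor X Y := phi Y \oc fmap G h \oc u; exists f.
apply: (qinv_faithful FG).
have := nat _ _ f; move/(congr1 (fun h => v \oc h)).
rewrite mcompA vphi mcomp1m => ->.
by rewrite /f !mcompA vphi mcomp1m -mcompA uphi mcompm1.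
Qed.

Variable E : autoeq C.

Lemma autoeq_faithful X Y (f g : mor X Y) : fmap E f = fmap E g -> f = g.
Proof. exact: (qinv_faithful (bwd_fwd E)). Qed.

Lemma autoeq_full X Y (h : mor (E X) (E Y)) : exists f, fmap E f = h.
Proof. exact: (qinv_full (bwd_fwd E) (fwd_bwd E)). Qed.

Lemma bwd_linear : linear_functor (bwd E).
Proof.
move=> X Y a f g; apply: autoeq_faithful.
have [psi [nat iso]] := qinvE (fwd_bwd E); case: (iso Y) => v [vpsi _].
rewrite -[LHS]mcomp1m -[RHS]mcomp1m -vpsi -!mcompA nat fwd_linear.
by rewrite compDr compZr !nat compDl compZl.
Qed.

Definition autoeq_op : autoeq C :=
  @Autoeq k C (bwd E) (fwd E) bwd_linear (fwd_bwd E) (bwd_fwd E).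

Lemma autoeq_bwd_fwd X : isomorphic (bwd E (E X)) X.
Proof. exact: (natiso_isomorphic X (bwd_fwd E)). Qed.

Lemma autoeq_fwd_bwd X : isomorphic (E (bwd E X)) X.
Proof. exact: (natiso_isomorphic X (fwd_bwd E)). Qed.

Lemma autoeq_additive : additive_functor E.
Proof. exact/linear_additive/fwd_linear. Qed.

Lemma autoeq0 X Y : fmap E (0 : mor X Y) = 0.
Proof. exact/additive_functor0/autoeq_additive. Qed.

Lemma autoeqD X Y (f g : mor X Y) : fmap E (f + g) = fmap E f + fmap E g.
Proof. exact: autoeq_additive. Qed.

Lemma autoeqN X Y (f : mor X Y) : fmap E (- f) = - fmap E f.
Proof. by apply: (addIr (fmap E f)); rewrite -autoeqD !addNr autoeq0. Qed.

Lemma autoeqB X Y (f g : mor X Y) : fmap E (f - g) = fmap E f - fmap E g.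
Proof. by rewrite autoeqD autoeqN. Qed.

Lemma orth_fwd X Y : orth (E X) (E Y) <-> orth X Y.
Proof.
split=> o f; first by apply: autoeq_faithful; rewrite autoeq0; apply: o.
by have [g <-] := autoeq_full f; rewrite (o g) autoeq0.
Qed.

Lemma orth_adjr X Y : orth (E X) Y <-> orth X (bwd E Y).
Proof.
apply: iff_trans (orth_fwd _ _).
exact/orth_isor/isomorphic_sym/autoeq_fwd_bwd.
Qed.

Lemma autoeq_iso X Y (f : mor X Y) : is_iso (fmap E f) -> is_iso f.
Proof.
case=> g; have [h <-] := autoeq_full g; rewrite -!fmapM -2!fmap1.
by case=> hf fh; exists h; split; apply: autoeq_faithful.
Qed.

Lemma autoeq_isomorphic X Y : isomorphic (E X) (E Y) <-> isomorphic X Y.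
Proof.
split=> [[f fi]|]; last exact: functor_isomorphic.
by have [g e] := autoeq_full f; exists g; apply: autoeq_iso; rewrite e.
Qed.

Lemma local_fwd X : local_end X -> local_end (E X).
Proof.
move=> [ne loc]; split=> [|f].
  by move=> e; apply: ne; apply: autoeq_faithful; rewrite autoeq0 fmap1.
have [g <-] := autoeq_full f; rewrite -fmap1 -autoeqB.
by case: (loc g) => i; [left|right]; apply: functor_iso.
Qed.

Lemma zero_fwd Z : is_zero Z -> is_zero (E Z).
Proof. by move=> /is_zeroP z; apply/is_zeroP; rewrite -fmap1 z autoeq0. Qed.

End Autoequivalence.

Section AutoequivalenceInverse.
Variables (k : fieldType) (C : linCat k) (E : autoeq C).
Implicit Types X Y : C.

Lemma orth_adjl X Y : orth (bwd E X) Y <-> orth X (E Y).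
Proof. exact: (orth_adjr (autoeq_op E)). Qed.

Lemma bwd_isomorphic X Y : isomorphic (bwd E X) (bwd E Y) <-> isomorphic X Y.
Proof. exact: (autoeq_isomorphic (autoeq_op E)). Qed.

End AutoequivalenceInverse.

(** * Triangles and cluster tilting filtrations *)

Section Triangles.
Variables (k : fieldType) (C : triCat k).
Implicit Types X Y Z W A B K : C.
Notation S := (shift C).

Lemma dist_comp0 X Y Z (f : mor X Y) (g : mor Y Z) (h : mor Z (S X)) :
  dist f g h -> g \oc f = 0.
Proof.
move=> t; have [Z0 z0] := has_zero C.
have [|c [<- _]] := TR3 (a := idmor X) (b := f) (TR1_id X z0) t.
  by rewrite mcompm1.
by rewrite comp0r.
Qed.

Lemma dist_rot X Y Z (f : mor X Y) (g : mor Y Z) (h : mor Z (S X)) :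
  dist f g h -> dist g h (- fmap S f).
Proof. by move/TR2. Qed.

Lemma dist_lift X Y Z W (f : mor X Y) (g : mor Y Z) (h : mor Z (S X))
    (u : mor W Y) :
  dist f g h -> g \oc u = 0 -> exists v, u = f \oc v.
Proof.
move=> t gu; have [Z0 z0] := has_zero C.
have [|c [_]] := TR3 (a := u) (b := 0) (dist_rot (TR1_id W z0)) (dist_rot t).
  by rewrite comp0l.
rewrite fmap1 compNr mcompm1 compNl => /oppr_inj.
have [v <-] := autoeq_full c; rewrite -fmapM => e.
by exists v; apply: autoeq_faithful e.
Qed.

Lemma dist_colift X Y Z W (f : mor X Y) (g : mor Y Z) (h : mor Z (S X))
    (u : mor Y W) :
  dist f g h -> u \oc f = 0 -> exists v, u = v \oc g.
Proof.
move=> t uf; have [Z0 z0] := has_zero C.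
have t0 : dist (0 : mor Z0 W) (idmor W) (0 : mor W (S Z0)).
  apply/TR2; rewrite autoeq0 oppr0; apply: TR1_id; exact: zero_fwd.
have [|c [e _]] := TR3 (a := 0) (b := u) t t0; first by rewrite comp0l.
by exists c; rewrite e mcomp1m.
Qed.

Lemma dist_shift X Y Z (f : mor X Y) (g : mor Y Z) (h : mor Z (S X)) :
  dist f g h -> dist (- fmap S f) (- fmap S g) (- fmap S h).
Proof. by move/dist_rot/dist_rot/dist_rot. Qed.

Lemma orth_distr X Y Z W (f : mor X Y) (g : mor Y Z) (h : mor Z (S X)) :
  dist f g h -> orth W X -> orth W Z -> orth W Y.
Proof.
move=> t oX oZ u; have [v ->] := dist_lift t (oZ (g \oc u)).
by rewrite (oX v) comp0r.
Qed.

Lemma orth_distl X Y Z W (f : mor X Y) (g : mor Y Z) (h : mor Z (S X)) :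
  dist f g h -> orth X W -> orth Z W -> orth Y W.
Proof.
move=> t oX oZ u; have [v ->] := dist_colift t (oX (u \oc f)).
by rewrite (oZ v) comp0l.
Qed.

Lemma TR1_fiber Y Z (g : mor Y Z) :
  exists X (f : mor X Y) (h : mor Z (S X)), dist f g h.
Proof.
have [W [a [b t]]] := TR1_cone g.
have [e [e' [e'e ee']]] := autoeq_fwd_bwd S W.
have [f fE] := autoeq_full (- (b \oc e)).
exists (bwd S W), f, (e' \oc a); apply/TR2.
apply: (TR1_iso (a := idmor Y) (b := idmor Z) (c := e')) t.
- exact: iso_id.
- exact: iso_id.
- by exists e.
- by rewrite mcomp1m mcompm1.
- by rewrite mcompm1.
- by rewrite fE opprK fmap1 mcomp1m -mcompA ee' mcompm1.
Qed.

(** To be applied to the difference of the middle components of two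
    endomorphisms of a triangle that agree on the outer terms. *)
Lemma dist_sq0 X Y Z (f : mor X Y) (g : mor Y Z) (h : mor Z (S X))
    (n : mor Y Y) :
  dist f g h -> n \oc f = 0 -> g \oc n = 0 -> n \oc n = 0.
Proof.
move=> t nf gn; have [c e] := dist_colift t nf.
by rewrite {1}e -mcompA gn comp0r.
Qed.

Lemma unipotent_inv X (m : mor X X) :
  (m - idmor X) \oc (m - idmor X) = 0 ->
  exists w, [/\ w \oc m = idmor X, m \oc w = idmor X
    & w = idmor X - (m - idmor X)].
Proof.
move: (subrK (idmor X) m); move: (m - idmor X) => n <- nn.
exists (idmor X - n); split=> //.
  by rewrite compBl !compDr !mcomp1m mcompm1 nn add0r [n + _]addrC addrK.
by rewrite compBr !compDl !mcompm1 mcomp1m nn add0r [n + _]addrC addrK.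
Qed.

(** A split monomorphism in a triangulated category has a complement: its
    cone, because the connecting map of the cone vanishes. *)
Lemma retract_complement X Y (s : mor X Y) (r : mor Y X) :
  r \oc s = idmor X -> exists Z (j : mor Z Y) (p : mor Y Z),
    [/\ p \oc j = idmor Z, p \oc s = 0, r \oc j = 0
      & s \oc r + j \oc p = idmor Y].
Proof.
move=> rs; have [Z [p [h t]]] := TR1_cone s.
have h0 : h = 0.
  have /dist_comp0 : dist h (- fmap S s) (- fmap S p) by do 2!apply: dist_rot.
  rewrite compNl => /eqP; rewrite oppr_eq0 => /eqP sh.
  by rewrite -(mcomp1m h) -fmap1 -rs fmapM -mcompA sh comp0r.
have [|q /esym pq] := dist_lift (u := idmor Z) (dist_rot t).
  by rewrite h0 comp0l.
have ps := dist_comp0 t.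
pose j := q - s \oc (r \oc q).
have pj : p \oc j = idmor Z by rewrite compBr pq mcompA ps comp0l subr0.
have rj : r \oc j = 0 by rewrite compBr mcompA rs mcomp1m subrr.
exists Z, j, p; split=> //.
have [|c e] := dist_lift (u := idmor Y - (s \oc r + j \oc p)) t.
  by rewrite compBr mcompm1 compDr !mcompA ps pj comp0l add0r mcomp1m subrr.
apply/esym/eqP; rewrite -subr_eq0 e.
suff -> : c = 0 by rewrite comp0r.
rewrite -(mcomp1m c) -rs -mcompA -e.
by rewrite compBr mcompm1 compDr !mcompA rs rj comp0l addr0 mcomp1m subrr.
Qed.

Lemma retract_summand X Y : retract X Y -> is_summand X Y.
Proof.
move=> [s [r rs]]; have [Z [j [p [pj ps rj e]]]] := retract_complement rs.
by exists Z, s, j, r, p.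
Qed.

(** The whole argument tracks only the vanishing of graded Hom spaces; negative
    degrees are avoided by moving shifts from one side to the other. *)
Definition hz n X Y := orth X (shiftn n Y).

Lemma hz_shiftr n X Y : hz n X (S Y) <-> hz n.+1 X Y.
Proof. by rewrite /hz /shiftn iterSr. Qed.

Lemma hz_shiftl n X Y : hz n.+1 (S X) Y <-> hz n X Y.
Proof. exact: orth_fwd. Qed.

Lemma hz_unshiftl n X Y : hz n (bwd S X) Y <-> hz n.+1 X Y.
Proof. exact: orth_adjl. Qed.

Lemma shiftn_retract n X Y : retract X Y -> retract (shiftn n X) (shiftn n Y).
Proof. by elim: n => //= n IH /IH; apply: functor_retract. Qed.

Lemma shiftn_isomorphic n X Y :
  isomorphic X Y -> isomorphic (shiftn n X) (shiftn n Y).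
Proof. by elim: n => //= n IH /IH; apply: functor_isomorphic. Qed.

Lemma hz_retract n X X' Y Y' :
  retract X X' -> retract Y Y' -> hz n X' Y' -> hz n X Y.
Proof. by move=> rX rY; apply: orth_retract => //; apply: shiftn_retract. Qed.

Lemma hz_dsum2l n A B X Y :
  is_dsum2 A B X -> hz n A Y -> hz n B Y -> hz n X Y.
Proof. exact: orth_dsum2l. Qed.

Lemma hz_dsum2r n A B X Y :
  is_dsum2 A B Y -> hz n X A -> hz n X B -> hz n X Y.
Proof.
rewrite /hz; elim: n A B Y => [|n IH] A B Y s; first exact: orth_dsum2r.
rewrite /shiftn !iterSr => oA oB; apply: IH oA oB.
by apply: functor_dsum2 => //; apply: autoeq_additive.
Qed.

Section OneTriangle.
Variables (A B Z : C) (f : mor A B) (g : mor B Z) (h : mor Z (S A)).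

Lemma hz_dist2r n W : dist f g h -> hz n W A -> hz n W Z -> hz n W B.
Proof.
elim: n A B Z f g h => [|n IH] A' B' Z' f' g' h' t; first exact: orth_distr t.
move=> /hz_shiftr oA /hz_shiftr oZ; apply/hz_shiftr.
exact: IH (dist_shift t) oA oZ.
Qed.

Lemma hz_dist2l n W : dist f g h -> hz n A W -> hz n Z W -> hz n B W.
Proof. exact: orth_distl. Qed.

End OneTriangle.

Section OneTriangleRotated.
Variables (A B Z : C) (f : mor A B) (g : mor B Z) (h : mor Z (S A)).
Hypothesis t : dist f g h.

Lemma hz_dist3r n W : hz n W B -> hz n.+1 W A -> hz n W Z.
Proof. by move=> oB /hz_shiftr oA; apply: hz_dist2r (dist_rot t) oB oA. Qed.

Lemma hz_dist1r n W : hz n.+1 W B -> hz n W Z -> hz n.+1 W A.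
Proof.
move=> /hz_shiftr oB oZ; apply/hz_shiftr.
exact: hz_dist2r (dist_rot (dist_rot t)) oZ oB.
Qed.

Lemma hz_dist3l n W : hz n.+1 B W -> hz n A W -> hz n.+1 Z W.
Proof. by move=> oB oA; apply: hz_dist2l (dist_rot t) oB _; apply/hz_shiftl. Qed.

Lemma hz_dist1l n W : hz n B W -> hz n.+1 Z W -> hz n A W.
Proof.
move=> oB oZ; apply/hz_shiftl.
by apply: hz_dist2l (dist_rot (dist_rot t)) oZ _; apply/hz_shiftl.
Qed.

(** A map to [A[1]] dies in [B[1]], so it comes from [Z], thus from [B] by the
    approximation property, and then it is zero in [A[1]]. *)
Lemma approx_hz1r W : hz 1 W B ->
  (forall w : mor W Z, exists v, w = g \oc v) -> hz 1 W A.
Proof.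
move=> oB app u; have t2 := dist_rot (dist_rot t).
have [|v ->] := dist_lift (u := u) t2; first by rewrite compNl (oB (fmap S f \oc u)) oppr0.
have [w ->] := app v.
by rewrite mcompA (dist_comp0 (dist_rot t)) comp0l.
Qed.

Lemma approx_hz1l W : hz 1 B W ->
  (forall w : mor A W, exists v, w = v \oc f) -> hz 1 Z W.
Proof.
move=> oB app u; have t1 := dist_rot t.
have [|v ->] := dist_colift (u := u) t1; first exact: oB.
have [w <-] := autoeq_full v; have [w' ->] := app w.
rewrite fmapM -mcompA; have /dist_comp0 := dist_rot t1.
by rewrite compNl => /eqP; rewrite oppr_eq0 => /eqP ->; rewrite comp0r.
Qed.

End OneTriangleRotated.

(** The class [P * P[1] * ... * P[n]] of iterated extensions. The recursive
    layer is the fibre [K] rather than [K[1]], so that no iterated shift of an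
    object occurs. *)
Inductive rfilt (P : C -> Prop) : nat -> C -> Prop :=
| rfilt0 X of P X : rfilt P 0 X
| rfiltS n K U X (f : mor K U) (g : mor U X) (h : mor X (S K))
    of P U & rfilt P n K & dist f g h : rfilt P n.+1 X.

(** Dually, [P[-n] * ... * P[-1] * P]. *)
Inductive lfilt (P : C -> Prop) : nat -> C -> Prop :=
| lfilt0 X of P X : lfilt P 0 X
| lfiltS n X V K (f : mor X V) (g : mor V K) (h : mor K (S X))
    of P V & lfilt P n K & dist f g h : lfilt P n.+1 X.

Lemma rfilt_mono (P Q : C -> Prop) n X :
  (forall U, P U -> Q U) -> rfilt P n X -> rfilt Q n X.
Proof.
move=> PQ; elim=> {n X} [X /PQ|n K U X f g h /PQ QU _ IH t].
  exact: rfilt0.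
exact: rfiltS QU IH t.
Qed.

Lemma lfilt_mono (P Q : C -> Prop) n X :
  (forall U, P U -> Q U) -> lfilt P n X -> lfilt Q n X.
Proof.
move=> PQ; elim=> {n X} [X /PQ|n X V K f g h /PQ QV _ IH t].
  exact: lfilt0.
exact: lfiltS QV IH t.
Qed.

Variables (d : nat) (P : C -> Prop).
Hypothesis (d_gt0 : (0 < d)%N) (ctP : ctilt d P).

Lemma ctilt_rigid U V i : P U -> P V -> (0 < i < d)%N -> hz i U V.
Proof. by move=> PU PV id f; case: ctP => _ ctr _; apply: (proj1 (ctr V)). Qed.

(** Iterated approximation: each fibre gains one more degree of orthogonality to
    [P], and an object with all of them is in [P]. *)
Lemma ctilt_rfilt X : rfilt P d.-1 X.
Proof.
have [[app _] ctr _] := ctP.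
suff gen m Y : (m < d)%N ->
    (forall U, P U -> forall i, (0 < i)%N -> (i + m < d)%N -> hz i U Y) ->
    rfilt P m Y.
  apply: gen => [|U PU i i0]; first by rewrite prednK.
  by rewrite -[X in (_ < X)%N](prednK d_gt0) ltnS -[X in (_ <= X)%N]add0n leq_add2r;
     case: (i) i0.
elim: m Y => [|m IH] Y md oY.
  by apply/rfilt0/ctr => U PU i /andP[i0 id]; apply: oY; rewrite ?addn0.
have [U [g [PU gapp]]] := app Y; have [K [f [h t]]] := TR1_fiber g.
apply: (rfiltS PU _ t); apply: IH; first exact: ltnW.
move=> V PV [|[|i]] // _ im.
  apply: (approx_hz1r t) => [|w]; last exact: gapp.
  by apply: ctilt_rigid => //; case: (d) md => [|[|]].
apply: (hz_dist1r t); last by apply: oY => //; rewrite addnS -addSn.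
by apply: ctilt_rigid => //; apply: leq_ltn_trans im; apply: leq_addr.
Qed.

Lemma ctilt_lfilt X : lfilt P d.-1 X.
Proof.
have [[_ app] _ ctl] := ctP.
suff gen m Y : (m < d)%N ->
    (forall U, P U -> forall i, (0 < i)%N -> (i + m < d)%N -> hz i Y U) ->
    lfilt P m Y.
  apply: gen => [|U PU i i0]; first by rewrite prednK.
  by rewrite -[X in (_ < X)%N](prednK d_gt0) ltnS -[X in (_ <= X)%N]add0n leq_add2r;
     case: (i) i0.
elim: m Y => [|m IH] Y md oY.
  by apply/lfilt0/ctl => U PU i /andP[i0 id]; apply: oY; rewrite ?addn0.
have [U [f [PU fapp]]] := app Y; have [K [g [h t]]] := TR1_cone f.
apply: (lfiltS PU _ t); apply: IH; first exact: ltnW.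
move=> V PV [|[|i]] // _ im.
  apply: (approx_hz1l t) => [|w]; last exact: fapp.
  by apply: ctilt_rigid => //; case: (d) md => [|[|]].
apply: (hz_dist3l t); last by apply: oY => //; rewrite addnS -addSn.
by apply: ctilt_rigid => //; apply: leq_ltn_trans im; apply: leq_addr.
Qed.

End Triangles.

(** * Additive closures and approximations *)

Section FiniteSums.
Variables (k : fieldType) (C : triCat k).
Implicit Types X Y Z W A B K : C.

Lemma dsum_cat n1 n2 (F1 : 'I_n1 -> C) (F2 : 'I_n2 -> C) Y1 Y2 Y :
  is_dsum F1 Y1 -> is_dsum F2 Y2 -> is_dsum2 Y1 Y2 Y ->
  is_dsum (fun i : 'I_(n1 + n2) =>
    match split i with inl a => F1 a | inr b => F2 b end) Y.
Proof.
move=> [j1 [q1 [e1 o1 s1]]] [j2 [q2 [e2 o2 s2]]].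
move=> [i1 [i2 [p1 [p2 [h1 h2 h3 h4 h5]]]]].
pose F (u : 'I_n1 + 'I_n2) := match u with inl a => F1 a | inr b => F2 b end.
pose inj (u : 'I_n1 + 'I_n2) : mor (F u) Y :=
  match u with inl a => i1 \oc j1 a | inr b => i2 \oc j2 b end.
pose proj (u : 'I_n1 + 'I_n2) : mor Y (F u) :=
  match u with inl a => q1 a \oc p1 | inr b => q2 b \oc p2 end.
have cmp A B (q : mor Y1 A) (j : mor B Y1) :
    (q \oc p1) \oc (i1 \oc j) = q \oc j.
  by rewrite mcompA -(mcompA q) h1 mcompm1.
have cmp' A B (q : mor Y2 A) (j : mor B Y2) :
    (q \oc p2) \oc (i2 \oc j) = q \oc j.
  by rewrite mcompA -(mcompA q) h2 mcompm1.
exists (fun i => inj (split i)), (fun i => proj (split i)); split.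
- by move=> i; case: (split i) => a /=; rewrite (cmp, cmp').
- move=> i j /eqP ij; have {ij} : split i <> split j.
    by move/(can_inj splitK).
  case: (split i) (split j) => a [b|b] /= ab.
  + by rewrite cmp o1 //; apply/eqP => e; rewrite e in ab.
  + by rewrite mcompA -(mcompA _ p2) h3 comp0r comp0l.
  + by rewrite mcompA -(mcompA _ p1) h4 comp0r comp0l.
  + by rewrite cmp' o2 //; apply/eqP => e; rewrite e in ab.
rewrite big_split_ord /= -h5 -[i1 in RHS]mcompm1 -[i2 in RHS]mcompm1 -s1 -s2.
rewrite !comp_sumr !comp_suml; congr (_ + _); apply: eq_bigr => a _.
  by rewrite (unsplitK (inl a)) /= !mcompA.
by rewrite (unsplitK (inr a)) /= !mcompA.
Qed.

Lemma dsum_nil X : is_zero X -> is_dsum (fun i : 'I_0 => X) X.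
Proof.
move=> /is_zeroP z; exists (fun _ => 0), (fun _ => 0).
by split=> [[]|[]|] //; rewrite big_ord0 z.
Qed.

Lemma dsum_one X : is_dsum (fun i : 'I_1 => X) X.
Proof.
exists (fun _ => idmor X), (fun _ => idmor X).
split=> [i|i j|]; rewrite ?mcomp1m //; first by rewrite !ord1 eqxx.
by rewrite big_ord_recl big_ord0 addr0.
Qed.

(** Membership in an additive closure is used only through this property and the
    induction principle [addcl_min]. *)
Definition add_closed (Q : C -> Prop) :=
  [/\ forall Z, is_zero Z -> Q Z,
      forall A B S, is_dsum2 A B S -> Q A -> Q B -> Q S
    & forall X Y, retract X Y -> Q Y -> Q X].

Lemma add_closed_sum (Q : C -> Prop) X Y n (F : 'I_n -> C)
    (a : forall i, mor X (F i)) (b : forall i, mor (F i) Y) :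
  add_closed Q -> (forall i, Q (F i)) ->
  exists W (s : mor X W) (r : mor W Y), Q W /\ r \oc s = \sum_i b i \oc a i.
Proof.
move=> [Q0 QD _]; elim: n F a b => [|n IH] F a b QF.
  have [Z z] := has_zero C; exists Z, 0, 0.
  by rewrite big_ord0 comp0l; split; first exact: Q0.
have [W [s [r [QW rs]]]] := IH _ (fun i => a (lift ord0 i))
  (fun i => b (lift ord0 i)) (fun i => QF (lift ord0 i)).
have [S dS] := has_dsum2 (F ord0) W.
have QS := QD _ _ _ dS (QF ord0) QW.
have [i1 [i2 [p1 [p2 [h1 h2 h3 h4 _]]]]] := dS.
exists S, (i1 \oc a ord0 + i2 \oc s), (b ord0 \oc p1 + r \oc p2); split=> //.
rewrite big_ord_recl -rs compDl !compDr !mcompA -!(mcompA _ p1) -!(mcompA _ p2).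
by rewrite h1 h2 h3 h4 !mcompm1 !comp0r !comp0l addr0 add0r.
Qed.

Lemma add_closed_dsum (Q : C -> Prop) n (F : 'I_n -> C) Y :
  add_closed Q -> is_dsum F Y -> (forall i, Q (F i)) -> Q Y.
Proof.
move=> Qc [inj [proj [_ _ e]]] QF.
have [W [s [r [QW rs]]]] := add_closed_sum proj inj Qc QF.
by case: Qc => _ _; apply; last exact: QW; exists s, r; rewrite rs.
Qed.

Lemma addcl_sub (P : C -> Prop) X : P X -> addcl P X.
Proof.
move=> PX; exists 1%N, (fun _ => X), X; split=> //; first exact: dsum_one.
exact/retract_summand/retract_refl.
Qed.

Lemma addcl_closed (P : C -> Prop) : add_closed (addcl P).
Proof.
split=> [Z z|A B S dS|X Y rXY].
- exists 0%N, (fun _ => Z), Z; split=> [[]||] //; first exact: dsum_nil.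
  exact/retract_summand/retract_refl.
- move=> [n1 [F1 [Y1 [PF1 d1 /summand_retract [s1 [r1 e1]]]]]].
  move=> [n2 [F2 [Y2 [PF2 d2 /summand_retract [s2 [r2 e2]]]]]].
  have [Y dY] := has_dsum2 Y1 Y2.
  exists (n1 + n2)%N, (fun i : 'I_(n1 + n2) =>
    match split i with inl a => F1 a | inr b => F2 b end), Y.
  split; last 1 first.
  + apply: retract_summand.
    have [i1 [i2 [p1 [p2 [_ _ _ _ e]]]]] := dS.
    have [j1 [j2 [q1 [q2 [h1 h2 h3 h4 _]]]]] := dY.
    exists (j1 \oc s1 \oc p1 + j2 \oc s2 \oc p2).
    exists (i1 \oc r1 \oc q1 + i2 \oc r2 \oc q2).
    rewrite compDl !compDr !mcompA -!(mcompA _ q1) -!(mcompA _ q2).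
    rewrite h1 h2 h3 h4 !comp0r !comp0l !mcompm1 addr0 add0r.
    by rewrite -(mcompA i1) -(mcompA i2) e1 e2 !mcompm1.
  + by move=> i; case: (split i).
  + exact: dsum_cat d1 d2 dY.
- move=> [n [F [Z [PF dF /summand_retract rY]]]]; exists n, F, Z; split=> //.
  exact/retract_summand/(retract_trans rXY).
Qed.

Lemma addcl_min (P Q : C -> Prop) :
  add_closed Q -> (forall X, P X -> Q X) -> forall X, addcl P X -> Q X.
Proof.
move=> Qc PQ X [n [F [Y [PF dF /summand_retract rX]]]].
have [_ _ Qr] := Qc; apply: (Qr _ _ rX).
by apply: add_closed_dsum Qc dF _ => i; apply: PQ.
Qed.

Lemma addcl_mono (P Q : C -> Prop) :
  (forall X, P X -> Q X) -> forall X, addcl P X -> addcl Q X.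
Proof.
move=> PQ; apply: addcl_min => [|X PX]; first exact: addcl_closed.
exact/addcl_sub/PQ.
Qed.

Lemma hz_closedl n Y : add_closed (fun X => hz n X Y).
Proof.
split=> [Z z|A B S|X X' rX]; [exact: orth0l | exact: hz_dsum2l |].
exact/hz_retract/retract_refl.
Qed.

Lemma shiftn_zero n Z : is_zero Z -> is_zero (shiftn n Z).
Proof. by move=> z; elim: n => //= n IH; apply: zero_fwd. Qed.

Lemma hz_closedr n X : add_closed (fun Y => hz n X Y).
Proof.
split=> [Z z|A B S|Y Y' rY]; [exact/orth0r/shiftn_zero | exact: hz_dsum2r |].
exact/hz_retract/rY/retract_refl.
Qed.

Lemma factor_closedr Q X (f : mor Q X) :
  add_closed (fun W => forall w : mor W X, exists h, w = f \oc h).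
Proof.
split=> [Z z w|A B S dS hA hB w|Y Y' [s [r rs]] hY' w].
- by exists 0; rewrite comp0r; apply: orth0l.
- have [i1 [i2 [p1 [p2 [_ _ _ _ e]]]]] := dS.
  have [a ea] := hA (w \oc i1); have [b eb] := hB (w \oc i2).
  exists (a \oc p1 + b \oc p2).
  by rewrite compDr !mcompA -ea -eb -!mcompA -compDr e mcompm1.
- have [h e] := hY' (w \oc r); exists (h \oc s).
  by rewrite mcompA -e -mcompA rs mcompm1.
Qed.

Lemma factor_closedl Q X (f : mor X Q) :
  add_closed (fun W => forall w : mor X W, exists h, w = h \oc f).
Proof.
split=> [Z z w|A B S dS hA hB w|Y Y' [s [r rs]] hY' w].
- by exists 0; rewrite comp0l; apply: orth0r.
- have [i1 [i2 [p1 [p2 [_ _ _ _ e]]]]] := dS.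
  have [a ea] := hA (p1 \oc w); have [b eb] := hB (p2 \oc w).
  exists (i1 \oc a + i2 \oc b).
  by rewrite compDl -!mcompA -ea -eb !mcompA -compDl e mcomp1m.
- have [h e] := hY' (s \oc w); exists (r \oc h).
  by rewrite -mcompA -e mcompA rs mcomp1m.
Qed.

Section Approximations.
Variable Q : C -> Prop.
Hypothesis Qc : add_closed Q.

Lemma joinr X R1 R2 (f1 : mor R1 X) (f2 : mor R2 X) : Q R1 -> Q R2 ->
  exists R (f : mor R X), Q R /\ forall W (w : mor W X),
    (exists h, w = f1 \oc h) \/ (exists h, w = f2 \oc h) ->
    exists h, w = f \oc h.
Proof.
case: Qc => _ QD _ Q1 Q2; have [S dS] := has_dsum2 R1 R2.
exists S; have [i1 [i2 [p1 [p2 [h1 h2 h3 h4 _]]]]] := dS.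
exists (f1 \oc p1 + f2 \oc p2); split; first exact: QD dS Q1 Q2.
move=> W w [] [h ->]; [exists (i1 \oc h) | exists (i2 \oc h)].
  by rewrite compDl !mcompA -!(mcompA _ _ i1) h1 h3 comp0r comp0l addr0 mcompm1.
by rewrite compDl !mcompA -!(mcompA _ _ i2) h2 h4 comp0r comp0l add0r mcompm1.
Qed.

Lemma joinl X R1 R2 (f1 : mor X R1) (f2 : mor X R2) : Q R1 -> Q R2 ->
  exists R (f : mor X R), Q R /\ forall W (w : mor X W),
    (exists h, w = h \oc f1) \/ (exists h, w = h \oc f2) ->
    exists h, w = h \oc f.
Proof.
case: Qc => _ QD _ Q1 Q2; have [S dS] := has_dsum2 R1 R2.
exists S; have [i1 [i2 [p1 [p2 [h1 h2 h3 h4 _]]]]] := dS.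
exists (i1 \oc f1 + i2 \oc f2); split; first exact: QD dS Q1 Q2.
move=> W w [] [h ->]; [exists (h \oc p1) | exists (h \oc p2)].
  by rewrite compDr -!mcompA !(mcompA p1) h1 h4 comp0l comp0r addr0 mcomp1m.
by rewrite compDr -!mcompA !(mcompA p2) h2 h3 comp0l comp0r add0r mcomp1m.
Qed.

(** Hom-finiteness: a basis of [mor W X] gives a map to [X] from a sum of copies
    of [W] through which all maps [W -> X] factor. *)
Lemma finite_approxr X (L : list C) : (forall W, List.In W L -> Q W) ->
  exists R (f : mor R X), Q R /\
    forall W, List.In W L -> forall w : mor W X, exists h, w = f \oc h.
Proof.
have [Q0 _ _] := Qc; have [Z z] := has_zero C.
elim: L => [|W L IH] QL; first by exists Z, 0; split; first exact: Q0.
have [V VL|R0 [f0 [QR0 app0]]] := IH; first by apply: QL; right.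
have QW : Q W by apply: QL; left.
have [R [f [QR app]]] : exists R (f : mor R X), Q R /\
    forall w : mor W X, exists h, w = f \oc h.
  have [R [f [QR app]]] : exists R (f : mor R X), Q R /\
      forall w, w \in tval (vbasis {: mor W X}) -> exists h, w = f \oc h.
    elim: (tval (vbasis {: mor W X})) => [|w ws [R [f [QR app]]]].
      by exists Z, 0; split=> //; apply: Q0.
    have [S [g [QS appS]]] := joinr w f QW QR; exists S, g; split=> // v.
    rewrite inE => /predU1P[->|vws]; apply: appS; last by right; apply: app.
    by left; exists (idmor W); rewrite mcompm1.
  exists R, f; split=> // w.
  have /memv_imgP[h _ ->] : w \in limg (linfun (@postcomp k C W R X f)).
    apply: subvP (memvf w); rewrite -(span_basis (vbasisP fullv)).
    apply/span_subvP => v /app[h ->]; apply/memv_imgP.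
    by exists h; rewrite ?memvf // lfunE.
  by exists h; rewrite lfunE.
have [S [g [QS appS]]] := joinr f0 f QR0 QR; exists S, g; split=> // V.
by case=> [<-|VL] w; apply: appS; [right; apply: app | left; apply: app0].
Qed.

Lemma finite_approxl X (L : list C) : (forall W, List.In W L -> Q W) ->
  exists R (f : mor X R), Q R /\
    forall W, List.In W L -> forall w : mor X W, exists h, w = h \oc f.
Proof.
have [Q0 _ _] := Qc; have [Z z] := has_zero C.
elim: L => [|W L IH] QL; first by exists Z, 0; split; first exact: Q0.
have [V VL|R0 [f0 [QR0 app0]]] := IH; first by apply: QL; right.
have QW : Q W by apply: QL; left.
have [R [f [QR app]]] : exists R (f : mor X R), Q R /\
    forall w : mor X W, exists h, w = h \oc f.
  have [R [f [QR app]]] : exists R (f : mor X R), Q R /\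
      forall w, w \in tval (vbasis {: mor X W}) -> exists h, w = h \oc f.
    elim: (tval (vbasis {: mor X W})) => [|w ws [R [f [QR app]]]].
      by exists Z, 0; split=> //; apply: Q0.
    have [S [g [QS appS]]] := joinl w f QW QR; exists S, g; split=> // v.
    rewrite inE => /predU1P[->|vws]; apply: appS; last by right; apply: app.
    by left; exists (idmor W); rewrite mcomp1m.
  exists R, f; split=> // w.
  have /memv_imgP[h _ ->] : w \in limg (linfun (@precomp k C X R W f)).
    apply: subvP (memvf w); rewrite -(span_basis (vbasisP fullv)).
    apply/span_subvP => v /app[h ->]; apply/memv_imgP.
    by exists h; rewrite ?memvf // lfunE.
  by exists h; rewrite lfunE.
have [S [g [QS appS]]] := joinl f0 f QR0 QR; exists S, g; split=> // V.
by case=> [<-|VL] w; apply: appS; [right; apply: app | left; apply: app0].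
Qed.

End Approximations.

(** Only the objects of [L] matter for approximations of [X], and they are
    finite in number. *)
Lemma addcl_functorially_finite (G : C -> Prop) :
  (forall X, exists L : list C, (forall W, List.In W L -> G W) /\
     forall W, G W -> orth W X /\ orth X W \/
       exists2 W', List.In W' L & isomorphic W W') ->
  functorially_finite (addcl G).
Proof.
move=> fin; split=> X; have [L [LG LX]] := fin X.
  have [W /LG/addcl_sub //|R [f [QR app]]] :=
    finite_approxr (addcl_closed G) X (L := L).
  exists R, f; split=> // W w GW; move: W GW w.
  apply: addcl_min (factor_closedr f) _ => W GW w.
  case: (LX W GW) => [[o _]|[W' /app{}app [u [v [vu uv]]]]].
    by exists 0; rewrite comp0r.
  have [h e] := app (w \oc v); exists (h \oc u).
  by rewrite mcompA -e -mcompA vu mcompm1.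
have [W /LG/addcl_sub //|R [f [QR app]]] :=
  finite_approxl (addcl_closed G) X (L := L).
exists R, f; split=> // W w GW; move: W GW w.
apply: addcl_min (factor_closedl f) _ => W GW w.
case: (LX W GW) => [[_ o]|[W' /app{}app [u [v [vu uv]]]]].
  by exists 0; rewrite comp0l.
have [h e] := app (u \oc w); exists (v \oc h).
by rewrite -mcompA -e mcompA vu mcomp1m.
Qed.

End FiniteSums.

(** * Control of a filtration by one rigid object *)

Section Core.
Variables (k : fieldType) (C : triCat k) (d : nat).
Implicit Types X Y Z W U V A B K : C.
Notation S := (shift C).

Definition rperp W Y := forall i, (0 < i < d)%N -> hz i W Y.

(** Equivalently, every map from [U] to an object of [rperp W] factors through a
    sum of copies of [W]. The present form mentions no triangle, so that
    equivalences transport it without being exact. *)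
Definition cogen W U := forall Y Z (g : mor Y Z), rperp W Y ->
  (forall w : mor W Y, g \oc w = 0) -> forall u : mor U Y, g \oc u = 0.

Lemma cogen_closed W : add_closed (cogen W).
Proof.
split=> [Z z|A B X dX cA cB|X X' [s [r rs]] cX] Y Z' g pY gw u.
- by rewrite (orth0l z u) comp0r.
- have [i1 [i2 [p1 [p2 [_ _ _ _ e]]]]] := dX.
  rewrite -(mcompm1 u) -e !compDr !mcompA -!(mcompA g u).
  by rewrite (cA _ _ _ pY gw) (cB _ _ _ pY gw) !comp0l addr0.
- by rewrite -(mcompm1 u) -rs !mcompA -(mcompA g) (cX _ _ _ pY gw) comp0l.
Qed.

Lemma cogen_retractl W W' U : retract W W' -> cogen W U -> cogen W' U.
Proof.
move=> rW cU Y Z g pY gw; apply: cU => [i id|w].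
  exact: hz_retract rW (retract_refl _) (pY i id).
have [s [r rs]] := rW.
by rewrite -(mcompm1 w) -rs !mcompA -(mcompA g) gw comp0l.
Qed.

Lemma lfilt_hz W n K Y i : lfilt (fun V => retract V W) n K -> rperp W Y ->
  (0 < i)%N -> (i + n < d)%N -> hz i K Y.
Proof.
move=> fK pY; have pV V j : retract V W -> (0 < j)%N -> (j < d)%N -> hz j V Y.
  by move=> rV j0 jd; apply: hz_retract rV (retract_refl Y) (pY j _); rewrite j0.
elim: fK i => {n K} [X rX|n X V K f g h rV _ IH t] i i0 id.
  by apply: pV; rewrite // -[i]addn0.
apply: (hz_dist1l t); last by apply: IH; rewrite // addSn -addnS.
by apply: pV => //; apply: leq_ltn_trans id; apply: leq_addr.
Qed.

(** A map from [U] to [Y] extends along the first map of the coresolution of [U],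
    because its cokernel term has no maps to [Y[1]]. *)
Lemma lfilt_cogen W n U : lfilt (fun V => retract V W) n U -> (n < d)%N -> cogen W U.
Proof.
have [_ _ cr] := cogen_closed W.
have cW : cogen W W by move=> Y Z g _; apply.
case=> {n U} [X rX _|n X V K f g h rV fK t nd]; first exact: cr rX cW.
move=> Y Z a pY aw u; have oK : hz 1 K Y by apply: lfilt_hz fK pY _ _.
have [|v e] := dist_colift (u := fmap S u) (dist_rot (dist_rot t)).
  exact: oK.
move: e; have [w <-] := autoeq_full v; rewrite compNr -fmapM -autoeqN => e.
rewrite (autoeq_faithful e) compNr mcompA.
by rewrite (cr _ _ rV cW _ _ _ pY aw) comp0l oppr0.
Qed.

(** The composite is a ghost: [h \oc x] vanishes on the first filtration layer
    of [K], so it is a shift of a map out of the remaining layers, into the next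
    fibre of an approximation; the hypothesis on [Z'] brings the vanishing found
    there back. *)
Lemma ghost_vanish W n K X' W0 Y (f : mor X' W0) (g : mor W0 Y)
    (h : mor Y (S X')) Z' (x : mor K Y) (t : mor Z' K) :
  rperp W W -> rfilt (cogen W) n K -> (n < d)%N -> rperp W Y ->
  addcl (fun V => V = W) W0 -> dist f g h ->
  (forall w : mor W Y, exists v, w = g \oc v) ->
  (forall i, (0 < i <= n)%N -> hz i Z' W) -> h \oc x \oc t = 0.
Proof.
move=> pW fK; elim: fK X' W0 Y f g h Z' x t => {n K}
  [K cK|n K' U K a b c cU _ IH tK] X' W0 Y f g h Z' x t.
  move=> _ pY _ tY app _; rewrite (cK _ _ h pY) ?comp0l // => w.
  have [v ->] := app w.
  by rewrite mcompA (dist_comp0 (dist_rot tY)) comp0l.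
move=> nd pY aW0 tY app oZ.
have hg := dist_comp0 (dist_rot tY).
have hw (w : mor W Y) : h \oc w = 0.
  by have [v ->] := app w; rewrite mcompA hg comp0l.
have [|v hx] := dist_colift (u := h \oc x) (dist_rot tK).
  by rewrite -mcompA; apply: cU hw _.
move: hx; have [x' <-] := autoeq_full v => hx.
have pW0 : rperp W W0.
  by move=> i id; apply: addcl_min (hz_closedr i W) _ _ aW0 => _ ->; apply: pW.
have pX' : rperp W X'.
  move=> [|[|i]] //= id; first by apply: (approx_hz1r tY); [apply: pW0|].
  by apply: (hz_dist1r tY); [apply: pW0 | apply: pY; rewrite /= ltnW].
have [V|W1 [g' [aW1 app']]] :=
  finite_approxr (addcl_closed (fun V => V = W)) X' (L := [:: W]).
  by case=> [<-|[]]; apply: addcl_sub.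
have [X'' [f' [h' tX']]] := TR1_fiber g'.
have [th [th' [_ thth']]] := autoeq_fwd_bwd S Z'.
have [t' t'E] := autoeq_full (c \oc t \oc th).
have h'x't' : h' \oc x' \oc t' = 0.
  apply: (IH _ _ _ f' g') => //; first exact: ltnW.
    by move=> w; apply: app' w; left.
  by move=> i /andP[i0 id]; apply/hz_unshiftl/oZ; rewrite /= ltnS.
have [|s sE] := dist_lift (u := x' \oc t') (dist_rot tX').
  by rewrite mcompA.
have s0 : s = 0.
  suff o : hz 0 (bwd S Z') W1 by apply: o.
  apply/hz_unshiftl; apply: addcl_min (hz_closedr _ _) _ _ aW1 => _ ->.
  exact: oZ.
have e : h \oc x \oc t \oc th = 0.
  rewrite hx -!mcompA (mcompA c) -t'E -fmapM.
  by rewrite sE s0 comp0r autoeq0.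
by rewrite -(mcompm1 t) -thth' !mcompA e comp0l.
Qed.

Hypothesis d_gt0 : (0 < d)%N.

(** Take the [W]-approximation of [X]; the connecting map is killed by
    [ghost_vanish] applied to the identity of [X]. *)
Lemma add_of_perp W X X1 : rperp W W -> rperp W X ->
  (forall i, (0 < i < d)%N -> hz i X W) ->
  retract X X1 -> rfilt (cogen W) d.-1 X1 -> addcl (fun V => V = W) X.
Proof.
move=> pW pX oX [s [r rs]] fX1.
have [V|W0 [g [aW0 app]]] :=
  finite_approxr (addcl_closed (fun V => V = W)) X (L := [:: W]).
  by case=> [<-|[]]; apply: addcl_sub.
have [X' [f [h tX]]] := TR1_fiber g.
have h0 : h = 0.
  rewrite -(mcompm1 h) -rs mcompA.
  apply: (ghost_vanish _ _ pW fX1 _ pX aW0 tX).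
  - by rewrite prednK.
  - by move=> w; apply: app; left.
  - by move=> i id; apply: oX; rewrite -(prednK d_gt0) ltnS.
have [|j /esym gj] := dist_lift (u := idmor X) (dist_rot tX).
  by rewrite h0 comp0l.
have [_ _ ar] := addcl_closed (fun V => V = W).
by apply: ar aW0; exists j, g.
Qed.

(** A finite filtration involves finitely many objects of [P], so one index
    serves them all. *)
Section Collect.
Variables (I : Type) (R : I -> C -> Prop) (P : C -> Prop).
Hypothesis R_directed : forall i j, exists l,
  (forall U, R i U -> R l U) /\ (forall U, R j U -> R l U).
Hypothesis PR : forall U, P U -> exists i, R i U.

Lemma rfilt_collect n X : rfilt P n X -> exists i, rfilt (R i) n X.
Proof.
elim=> {n X} [X /PR[i Ri]|n K U X f g h /PR[i Ri] _ [j Rj] t].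
  by exists i; apply: rfilt0.
have [l [il jl]] := R_directed i j; exists l.
exact: rfiltS (il _ Ri) (rfilt_mono jl Rj) t.
Qed.

Lemma lfilt_collect n X : lfilt P n X -> exists i, lfilt (R i) n X.
Proof.
elim=> {n X} [X /PR[i Ri]|n X V K f g h /PR[i Ri] _ [j Rj] t].
  by exists i; apply: lfilt0.
have [l [il jl]] := R_directed i j; exists l.
exact: lfiltS (il _ Ri) (lfilt_mono jl Rj) t.
Qed.

End Collect.

End Core.

(** * Autoequivalences and Serre duality *)

Section Autoequivalences.
Variables (k : fieldType).

Fact idF_linear (C : linCat k) : linear_functor (idF C).
Proof. by []. Qed.

Fact idF_qinv (C : linCat k) :
  naturally_isomorphic (compF (idF C) (idF C)) (idF C).
Proof.
exists (fun X => idmor X); split=> [X Y f|X]; last exact: iso_id.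
by rewrite /= mcomp1m mcompm1.
Qed.

Definition idE (C : linCat k) : autoeq C :=
  @Autoeq k C (idF C) (idF C) (@idF_linear C) (idF_qinv C) (idF_qinv C).

Lemma compF_qinv (C : linCat k) (F F' G G' : functor C C) :
  naturally_isomorphic (compF F' F) (idF C) ->
  naturally_isomorphic (compF G' G) (idF C) ->
  naturally_isomorphic (compF (compF F' G') (compF G F)) (idF C).
Proof.
move=> [phi [nphi iphi]] [psi [npsi ipsi]].
exists (fun X => phi X \oc fmap F' (psi (F X))); split=> [X Y f|X] /=.
  rewrite -mcompA -fmapM (npsi _ _ (fmap F f)) /= fmapM mcompA.
  by rewrite (nphi _ _ f) /= mcompA.
by apply: iso_comp; [apply: iphi | apply/functor_iso/ipsi].
Qed.

Fact compF_linear (C : linCat k) (E F : autoeq C) : linear_functor (compF E F).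
Proof. by move=> X Y a f g; rewrite /= !fwd_linear. Qed.

Definition compE (C : linCat k) (E F : autoeq C) : autoeq C :=
  @Autoeq k C (compF E F) (compF (bwd F) (bwd E)) (@compF_linear C E F)
    (compF_qinv (bwd_fwd F) (bwd_fwd E)) (compF_qinv (fwd_bwd E) (fwd_bwd F)).

Definition iterE (C : linCat k) n (E : autoeq C) := iter n (compE E) (idE C).

Lemma iterE_obj (C : linCat k) n (E : autoeq C) (X : C) : iterE n E X = iter n E X.
Proof. by elim: n => //= n ->. Qed.

Lemma iterE_bwd (C : linCat k) n (E : autoeq C) (X : C) :
  bwd (iterE n E) X = iter n (bwd E) X.
Proof. by elim: n X => //= n IH X; rewrite IH -iterSr. Qed.

Variable C : triCat k.
Implicit Types X Y A : C.
Notation S := (shift C).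

(** Commutation with shifts, as far as the vanishing of Hom spaces can see it. *)
Definition hz_compat (E : autoeq C) :=
  forall i A Y, hz i (E A) Y <-> hz i A (bwd E Y).

Lemma hz_isol i X X' Y : isomorphic X X' -> hz i X Y <-> hz i X' Y.
Proof. exact: orth_isol. Qed.

Lemma hz_isor i X Y Y' : isomorphic Y Y' -> hz i X Y <-> hz i X Y'.
Proof. by move=> /(shiftn_isomorphic i); apply: orth_isor. Qed.

Lemma hz_compat_shift : hz_compat S.
Proof.
move=> i A Y; apply: iff_trans (hz_shiftl _ _ _).
apply: iff_trans (hz_shiftr _ _ _).
exact/hz_isor/isomorphic_sym/autoeq_fwd_bwd.
Qed.

Lemma hz_compat_op E : hz_compat E -> hz_compat (autoeq_op E).
Proof.
move=> cE i A Y /=; apply: iff_trans (hz_isol _ _ (autoeq_fwd_bwd E A)).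
apply: iff_trans (iff_sym (cE _ _ _)).
exact/hz_isor/isomorphic_sym/autoeq_bwd_fwd.
Qed.

Lemma hz_compat_comp E F : hz_compat E -> hz_compat F -> hz_compat (compE E F).
Proof. by move=> cE cF i A Y; apply: iff_trans (cE _ _ _) (cF _ _ _). Qed.

Lemma hz_compat_iter n E : hz_compat E -> hz_compat (iterE n E).
Proof. by move=> cE; elim: n => //= n IH; apply: hz_compat_comp. Qed.

Lemma cogen_transport d E W U : hz_compat E -> cogen d W U ->
  cogen d (E W) (E U).
Proof.
move=> cE cU Y Z g pY gw u.
have [eps [nat iso]] := qinvE (fwd_bwd E).
have gu (u' : mor U (bwd E Y)) : fmap (bwd E) g \oc u' = 0.
  apply: cU => [i id|w]; first exact/cE/pY.
  apply: (autoeq_faithful (E := E)); rewrite fmapM autoeq0.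
  have [mu [etaeps _]] := iso Z.
  have e0 : eps Z \oc (fmap E (fmap (bwd E) g) \oc fmap E w) = 0.
    by rewrite mcompA nat -mcompA gw.
  move/(congr1 (mcomp mu)): e0; rewrite comp0r mcompA etaeps.
  by rewrite mcomp1m.
have [eta [_ epseta]] := iso Y.
have [u' u'E] := autoeq_full (eta \oc u).
rewrite -(mcomp1m u) -epseta -mcompA -u'E mcompA -nat -mcompA -fmapM gu.
by rewrite autoeq0 comp0r.
Qed.

End Autoequivalences.

Section Dual.
Variable k : fieldType.

(** Linear forms take values in the regular module, hence this retyping. *)
Definition coordo (V : vectType k) i (v : V) : k^o := coord (vbasis {: V}) i v.

Fact coordo_is_linear (V : vectType k) i : linear (@coordo V i).
Proof. exact: coord_is_scalar. Qed.
HB.instance Definition _ (V : vectType k) i :=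
  GRing.isLinear.Build k V k^o *:%R (@coordo V i) (@coordo_is_linear V i).

Lemma dual_eq0 (V : vectType k) :
  (forall phi : 'Hom(V, k^o), phi = 0) -> forall v : V, v = 0.
Proof.
move=> V0 v; rewrite (coord_vbasis (memvf v)); apply: big1 => i _.
have := lfunE (coordo i) v.
by rewrite (V0 (linfun (coordo i))) lfunE /= /coordo => <-; rewrite scale0r.
Qed.

End Dual.

Section Serre.
Variables (k : fieldType) (C : triCat k) (nu : serreFunctor C).
Implicit Types X Y A V W : C.
Notation S := (shift C).

Lemma serre_orth X Y : orth X Y <-> orth Y (nu X).
Proof.
have [eta [lin bij _ _]] := serreP nu.
have eta0 : eta X Y 0 = 0.
  have := lin X Y 1 0 0; rewrite !scale1r addr0 => e.
  by apply: (addrI (eta X Y 0)); rewrite addr0 -e.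
split=> o.
  move=> f; case: (bij X Y) => inv _ invK; rewrite -(invK f) (_ : inv f = 0) //.
  by apply/lfunP => v; rewrite (o v) !linear0.
apply: dual_eq0 => phi; apply: (bij_inj (bij X Y)); rewrite eta0.
exact: o.
Qed.

Lemma hz_unshiftn n m X Y : hz n (unshiftn m X) Y <-> hz (n + m) X Y.
Proof.
elim: m n => [|m IH] n; first by rewrite addn0.
by apply: iff_trans (hz_unshiftl _ _ _) _; rewrite addnS -addSn; apply: IH.
Qed.

Lemma orth_shiftn n X Y : orth (shiftn n X) Y <-> orth X (unshiftn n Y).
Proof.
elim: n Y => //= n IH Y; apply: iff_trans (orth_adjr _ _ _) _.
by apply: iff_trans (IH _) _; rewrite /unshiftn -iterSr.
Qed.

Lemma shiftn_unshiftn n X : isomorphic (shiftn n (unshiftn n X)) X.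
Proof.
rewrite /shiftn /unshiftn -iterE_bwd -(iterE_obj n S).
exact: autoeq_fwd_bwd.
Qed.

Lemma hz_serre j X Y : hz j X (nu Y) <-> orth (shiftn j Y) X.
Proof.
apply: iff_trans (iff_sym (hz_unshiftn 0 j X (nu Y))) _.
exact: iff_trans (iff_sym (serre_orth _ _)) (iff_sym (orth_shiftn _ _ _)).
Qed.

(** Serre duality between positive extensions: [nud d] exchanges the degrees
    [j] and [d - j]. *)
Lemma hz_nud d j X V : (j <= d)%N -> hz j X (nud nu d V) <-> hz (d - j) V X.
Proof.
move=> jd; apply: iff_trans (hz_serre _ _ _) _.
rewrite -{1}(subnKC jd) /unshiftn iterD -!/(unshiftn _ _).
apply: iff_trans (orth_isol _ (shiftn_unshiftn _ _)) _.
exact: (hz_unshiftn 0).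
Qed.

(** Apply Serre duality twice: both sides say that [A] has no maps to the shifts
    of a preimage of [Y]. *)
Lemma hz_compat_serre : hz_compat nu.
Proof.
move=> i A Y.
apply: iff_trans (hz_isor _ _ (isomorphic_sym (autoeq_fwd_bwd nu Y))) _.
apply: iff_trans (hz_serre _ _ _) _.
exact: iff_sym (serre_orth _ _).
Qed.

Variable d : nat.

Definition nudE : autoeq C := compE nu (iterE d (autoeq_op S)).

Lemma nudE_obj X : nudE X = nud nu d X.
Proof. by rewrite /= iterE_obj. Qed.

Lemma nudE_bwd X : bwd nudE X = nud_inv nu d X.
Proof. by rewrite /= iterE_bwd. Qed.

Lemma hz_compat_nud : hz_compat nudE.
Proof.
apply: hz_compat_comp; first exact: hz_compat_serre.
exact/hz_compat_iter/hz_compat_op/hz_compat_shift.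
Qed.

(** Powers of an autoequivalence as autoequivalences, so that the transport
    lemmas apply to them. *)
Definition powE (E : autoeq C) (i : int) : autoeq C :=
  match i with Posz n => iterE n E | Negz n => iterE n.+1 (autoeq_op E) end.

Lemma powE_nud i X : powE nudE i X = nud_pow nu d i X.
Proof.
case: i => n; rewrite [LHS]iterE_obj; apply: eq_iter => {}X.
  exact: nudE_obj.
exact: nudE_bwd.
Qed.

Lemma hz_compat_pow E i : hz_compat E -> hz_compat (powE E i).
Proof.
by move=> cE; case: i => n; apply: hz_compat_iter => //; apply: hz_compat_op.
Qed.

End Serre.

(** * The image of a cluster tilting subcategory *)

Lemma subn_range i d : (0 < i < d)%N -> (0 < d - i < d)%N.
Proof.
by move=> /andP[i0 id]; rewrite subn_gt0 id ltn_subrL i0 (leq_ltn_trans _ id).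
Qed.

Section ClusterTilting.
Variables (k : fieldType) (C : triCat k) (nu : serreFunctor C) (d : nat).
Variable P : C -> Prop.
Hypothesis ctP : ctilt d P.
Implicit Types X Y : C.

Lemma ctilt_closed : add_closed P.
Proof.
case: ctP => _ ctr _; split=> [Z z|A B S dS PA PB|X Y rX PY]; apply/ctr.
- by move=> U _ i _; apply/orth0r/shiftn_zero.
- move=> U PU i id; apply: (hz_dsum2r dS); move: i id U PU.
    by move=> i id U PU; apply: (proj1 (ctr A) PA).
  by move=> i id U PU; apply: (proj1 (ctr B) PB).
- move=> U PU i id; apply: hz_retract (retract_refl U) rX _.
  exact: (proj1 (ctr Y) PY).
Qed.

Lemma ctilt_nud X : P X -> P (nud nu d X).
Proof.
case: ctP => _ ctr _ PX; apply/ctr => U PU i id.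
apply/hz_nud; first by case/andP: id => _ /ltnW.
by apply: (ctilt_rigid ctP) => //; apply: subn_range.
Qed.

Lemma ctilt_nud_inv X : P X -> P (nud_inv nu d X).
Proof.
case: ctP => _ _ ctl PX; apply/ctl => U PU i id.
rewrite -[i](@subKn i d); last by case/andP: id => _ /ltnW.
apply/hz_nud; first exact: leq_subr.
have e : isomorphic (nud nu d (nud_inv nu d X)) X.
  by rewrite -nudE_obj -nudE_bwd; apply: autoeq_fwd_bwd.
apply/(hz_isor _ _ e).
by apply: (ctilt_rigid ctP) => //; apply: subn_range.
Qed.

Lemma ctilt_nud_pow i X : P X -> P (nud_pow nu d i X).
Proof.
case: i => n PX /=; elim: n => [|n IH] //=; try exact: ctilt_nud.
  exact: ctilt_nud_inv.
exact: ctilt_nud_inv.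
Qed.

End ClusterTilting.

Lemma functorially_finite_ext (k : fieldType) (C : linCat k) (P Q : C -> Prop) :
  (forall X, P X <-> Q X) -> functorially_finite P -> functorially_finite Q.
Proof.
move=> PQ [appr appl]; split=> X.
  have [U [f [PU app]]] := appr X; exists U, f; split; first exact/PQ.
  by move=> V g /PQ; apply: app.
have [U [f [PU app]]] := appl X; exists U, f; split; first exact/PQ.
by move=> V g /PQ; apply: app.
Qed.

Section Image.
Variables (k : fieldType) (d : nat) (C D : triCat k).
Variables (nuC : serreFunctor C) (nuD : serreFunctor D) (pi : functor D C).
Hypothesis d_gt0 : (0 < d)%N.
Hypothesis pi_tri : triangle_functor pi.
Hypothesis pi_nu : commutes_with_serre nuD nuC pi.
Hypothesis pi_rigid : preserves_rigidity d pi.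

Lemma pi_shift X : isomorphic (pi (shift D X)) (shift C (pi X)).
Proof.
have [_ [phi [nphi _]]] := pi_tri.
by apply: (natiso_isomorphic (F := compF pi (shift D))
  (G := compF (shift C) pi)); exists phi.
Qed.

Lemma pi_unshiftn n X : isomorphic (pi (unshiftn n X)) (unshiftn n (pi X)).
Proof.
elim: n X => [|n IH] X; first exact: isomorphic_refl.
rewrite /unshiftn /= -/(unshiftn n X) -/(unshiftn n (pi X)).
set Y := unshiftn n X.
apply: isomorphic_trans (functor_isomorphic (bwd (shift C)) (IH X)).
apply: isomorphic_trans (isomorphic_sym (autoeq_bwd_fwd (shift C) _)) _.
apply: functor_isomorphic.
apply: isomorphic_trans (isomorphic_sym (pi_shift _)) _.
exact/functor_isomorphic/autoeq_fwd_bwd.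
Qed.

Lemma pi_nud X : isomorphic (pi (nud nuD d X)) (nud nuC d (pi X)).
Proof.
apply: isomorphic_trans (natiso_isomorphic (unshiftn d X) pi_nu) _.
exact: (functor_isomorphic nuC (pi_unshiftn d X)).
Qed.

Lemma lfilt_image P n X :
  lfilt P n X -> lfilt (fun Y => exists X, P X /\ Y = pi X) n (pi X).
Proof.
have [_ [phi [_ tri]]] := pi_tri.
elim=> {n X} [X PX|n X V K f g h PV _ IH t].
  by apply: lfilt0; exists X.
by apply: lfiltS IH (tri _ _ _ _ _ _ t); exists V.
Qed.

Variable V : D -> Prop.
Hypothesis ctV : ctilt d V.
Let piV := image_add pi V.

Lemma image_rigid X Y i : piV X -> piV Y -> (0 < i < d)%N -> hz i X Y.
Proof.
move=> VX VY id; apply: pi_rigid VX VY i id => {X Y} X Y VX VY {}i id.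
exact: (ctilt_rigid ctV).
Qed.

Let piV_sub X : V X -> piV (pi X).
Proof. by move=> VX; apply: addcl_sub; exists X. Qed.

Lemma image_nud X : piV X -> piV (nudE nuC d X).
Proof.
have [V0 VD Vr] := addcl_closed (fun Y => exists X, V X /\ Y = pi X).
move: X; apply: addcl_min => [|_ [Y [VY ->]]].
  split=> [Z z|A B S dS|A B rAB].
  - exact/V0/zero_fwd.
  - by apply: VD; apply: functor_dsum2 dS; apply: autoeq_additive.
  - by apply: Vr; apply: functor_retract.
rewrite nudE_obj; apply: Vr (piV_sub (ctilt_nud nuD ctV VY)).
exact/isomorphic_retract/isomorphic_sym/pi_nud.
Qed.

Lemma image_nud_inv X : piV X -> piV (bwd (nudE nuC d) X).
Proof.
have [V0 VD Vr] := addcl_closed (fun Y => exists X, V X /\ Y = pi X).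
move: X; apply: addcl_min => [|_ [Y [VY ->]]].
  split=> [Z z|A B S dS|A B rAB].
  - exact/V0/(zero_fwd (autoeq_op (nudE nuC d))).
  - apply: VD; apply: functor_dsum2 dS.
    exact: (autoeq_additive (autoeq_op (nudE nuC d))).
  - by apply: Vr; apply: functor_retract.
apply: Vr (piV_sub (ctilt_nud_inv nuD ctV VY)); apply: isomorphic_retract.
apply: isomorphic_trans (autoeq_bwd_fwd (nudE nuC d) _).
apply: functor_isomorphic; rewrite [X in isomorphic _ X]nudE_obj.
apply: isomorphic_trans (pi_nud _); apply: functor_isomorphic.
by rewrite -nudE_obj -nudE_bwd; apply/isomorphic_sym/autoeq_fwd_bwd.
Qed.

Lemma image_powE i X : piV X -> piV (powE (nudE nuC d) i X).
Proof.
move=> VX.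
have pos n : piV (iterE n (nudE nuC d) X).
  by rewrite iterE_obj; elim: n => //= n; apply: image_nud.
have neg n : piV (iterE n (autoeq_op (nudE nuC d)) X).
  by rewrite iterE_obj; elim: n => //= n; apply: image_nud_inv.
by case: i => n; [apply: pos | apply: neg].
Qed.

(** [pi V] is stable under [nud] and its inverse because [V] is, so Serre duality
    exchanges its left and right orthogonality conditions. *)
Lemma image_perp_sym X :
  (forall Q, piV Q -> rperp d Q X) <->
  (forall Q, piV Q -> forall i, (0 < i < d)%N -> hz i X Q).
Proof.
split=> o.
  suff oV Y : V Y -> forall i, (0 < i < d)%N -> hz i X (pi Y).
    move=> Q + i id; apply: addcl_min (hz_closedr i X) _ Q => _ [Y [VY ->]].
    exact: oV.
  move=> VY i id; have VY' := ctilt_nud_inv nuD ctV VY.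
  have e : isomorphic (nud nuC d (pi (nud_inv nuD d Y))) (pi Y).
    apply: isomorphic_trans (isomorphic_sym (pi_nud _)) _.
    apply: functor_isomorphic; rewrite -nudE_obj -nudE_bwd.
    exact: autoeq_fwd_bwd.
  apply/(hz_isor _ _ e)/hz_nud; first by case/andP: id => _ /ltnW.
  by apply: o; [apply: piV_sub | apply: subn_range].
suff oV Y : V Y -> rperp d (pi Y) X.
  move=> Q + i id; apply: addcl_min (hz_closedl i X) _ Q => _ [Y [VY ->]].
  exact: oV.
move=> VY i id.
have id' : (i <= d)%N by case/andP: id => _ /ltnW.
rewrite -(subKn id'); apply/(hz_nud nuC); first exact: leq_subr.
apply/(hz_isor _ _ (isomorphic_sym (pi_nud Y))).
apply: o; last exact: subn_range.
exact: (piV_sub (ctilt_nud nuD ctV VY)).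
Qed.

Lemma cogen_directed (G : C -> Prop) : add_closed G ->
  forall W W' : {W | G W}, exists W'' : {W | G W},
  retract (sval W) (sval W'') /\ retract (sval W') (sval W'').
Proof.
move=> [_ GD _] [W GW] [W' GW']; have [S dS] := has_dsum2 W W'.
exists (exist _ S (GD _ _ _ dS GW GW')).
by split; [apply: dsum2_retractl dS | apply: dsum2_retractr dS].
Qed.

Lemma cogen_exists_closed (G : C -> Prop) : add_closed G ->
  add_closed (fun U => exists2 W, G W & cogen d W U).
Proof.
move=> Gc; have [G0 _ _] := Gc.
split=> [Z z|A B S dS [W GW cA] [W' GW' cB]|X Y rX [W GW cY]].
- by exists Z; [apply: G0 | have [c0 _ _] := cogen_closed d Z; apply: c0].
- have [[W'' GW''] /= [r r']] := cogen_directed Gc (exist _ W GW) (exist _ W' GW').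
  exists W'' => //; have [_ cD _] := cogen_closed d W''.
  exact: cD dS (cogen_retractl r cA) (cogen_retractl r' cB).
- by exists W => //; have [_ _ cr] := cogen_closed d W; apply: cr rX cY.
Qed.

(** Apply [pi] to a coresolution by [V]; the sum of its finitely many terms does
    the job. *)
Lemma image_cogen U Q : image_add pi U Q -> exists2 W, piV W & cogen d W Q.
Proof.
have Vc : add_closed piV := addcl_closed _.
apply: addcl_min (cogen_exists_closed Vc) _ Q => _ [X [_ ->]].
have fX := lfilt_image (ctilt_lfilt d_gt0 ctV X).
have [||[W VW] fW] := lfilt_collect (I := {W | piV W})
    (R := fun W Y => retract Y (sval W)) _ _ fX.
- move=> W W'; have [W'' [r r']] := cogen_directed Vc W W'; exists W''.
  by split=> Y rY; [apply: retract_trans r | apply: retract_trans r'].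
- move=> _ [Y [VY ->]]; exists (exist _ (pi Y) (piV_sub VY)).
  exact: retract_refl.
by exists W => //; apply: lfilt_cogen fW _; rewrite prednK.
Qed.

Variable U : C -> Prop.
Hypothesis ctU : ctilt d U.

(** The filtration of [X] by [U] is controlled by one object of [G], so [X] is
    in the additive closure of that object. *)
Lemma perp_image_add (G : C -> Prop) X : add_closed G ->
  (forall Q, G Q -> piV Q) -> (forall Q, U Q -> exists2 W, G W & cogen d W Q) ->
  (forall Q, piV Q -> rperp d Q X) -> G X.
Proof.
move=> Gc GV UG pX; have oX := proj1 (image_perp_sym X) pX.
have [||[W GW] fW] := rfilt_collect (I := {W | G W})
    (R := fun W Y => cogen d (sval W) Y) _ _ (ctilt_rfilt d_gt0 ctU X).
- move=> W W'; have [W'' [r r']] := cogen_directed Gc W W'; exists W''.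
  by split=> Y; apply: cogen_retractl.
- by move=> Q /UG[W GW cW]; exists (exist _ W GW).
have VW := GV _ GW.
apply: (addcl_min Gc (P := fun Q => Q = W)) => [_ -> //|].
have {}fW : rfilt (cogen d W) d.-1 X := fW.
apply: (add_of_perp d_gt0 _ _ _ (retract_refl X) fW).
- by move=> i; apply: image_rigid.
- exact: pX.
- exact: oX.
Qed.

Hypothesis U_image : forall Q, U Q -> exists2 W, piV W & cogen d W Q.

Lemma image_rperp X : piV X <-> (forall Q, piV Q -> rperp d Q X).
Proof.
split=> [VX Q VQ i id|pX]; first exact: image_rigid.
exact: perp_image_add (addcl_closed _) _ U_image pX.
Qed.

Lemma image_ctilt : functorially_finite piV -> ctilt d piV.
Proof.
move=> ff; split=> // X; first exact: image_rperp.
exact: iff_trans (image_rperp X) (image_perp_sym X).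
Qed.

(** The source of additive generators: take for [G] the additive closure of an
    object, or of an orbit, that controls a generator of [U]. *)
Lemma image_generated (G : C -> Prop) : add_closed G ->
  (forall Q, G Q -> piV Q) -> (forall Q, U Q -> exists2 W, G W & cogen d W Q) ->
  forall X, piV X <-> G X.
Proof.
move=> Gc GV UG X; split=> [VX|]; last exact: GV.
by apply: (perp_image_add Gc GV UG) => Q VQ i id; apply: image_rigid.
Qed.

End Image.

(** * Fitting's lemma and split idempotents *)

Section Fitting.
Variables (k : fieldType) (C : linCat k).
Implicit Types X Y : C.

Definition pw X (a : mor X X) n : mor X X := iter n (mcomp a) (idmor X).

Definition pev X (c : seq k) (a : mor X X) : mor X X :=
  foldr (fun x r => x *: idmor X + a \oc r) 0 c.

Lemma pw_nat X Y (g : mor X Y) a e n : g \oc a = e \oc g ->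
  g \oc pw a n = pw e n \oc g.
Proof.
move=> ga; elim: n => [|n IH] /=; first by rewrite mcomp1m mcompm1.
by rewrite mcompA ga -mcompA IH mcompA.
Qed.

Lemma pev_nat X Y (g : mor X Y) a e c : g \oc a = e \oc g ->
  g \oc pev c a = pev c e \oc g.
Proof.
move=> ga; elim: c => [|x c IH] /=; first by rewrite comp0r comp0l.
by rewrite compDr compDl compZr compZl mcompm1 mcomp1m mcompA ga -!mcompA IH.
Qed.

Lemma pwD X (a : mor X X) m n : pw a (m + n) = pw a m \oc pw a n.
Proof. by elim: m => [|m IH] /=; rewrite ?mcomp1m // IH mcompA. Qed.

Lemma pwSr X (a : mor X X) n : pw a n.+1 = pw a n \oc a.
Proof. by rewrite -addn1 pwD /= mcompm1. Qed.

Lemma pwM X (a b : mor X X) n : a \oc b = b \oc a ->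
  pw (a \oc b) n = pw b n \oc pw a n.
Proof.
move=> ab; elim: n => [|n IH] /=; first by rewrite mcomp1m.
rewrite IH ab -!mcompA; congr (_ \oc _); rewrite !mcompA; congr (_ \oc _).
exact: pw_nat.
Qed.

Lemma pw_span X (a : mor X X) m l v :
  v \in <<[seq pw a i | i <- iota m l]>>%VS ->
  exists c, v = pw a m \oc pev c a.
Proof.
elim: l m v => [|l IH] m v /=.
  by rewrite span_nil memv0 => /eqP ->; exists [::]; rewrite comp0r.
rewrite span_cons => /memv_addP[u /vlineP[x ->] [w /IH[c ->] ->]].
exists (x :: c); rewrite /= compDr compZr mcompm1; congr (_ + _).
by rewrite mcompA -pwSr.
Qed.

Lemma pw_dependent X (a : mor X X) :
  exists N c, pw a N = pw a N.+1 \oc pev c a.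
Proof.
set n := (\dim {: mor X X}).+1.
pose s := [seq pw a i | i <- iota 0 n].
have ss : size s == n by rewrite size_map size_iota.
have : ~~ free (Tuple ss).
  by rewrite /free neq_ltn size_tuple ltnS dimvS ?subvf.
rewrite freeNE => /existsP[i si]; exists i.
move: si; rewrite /= -map_drop drop_iota (nth_map 0) ?size_iota //.
by rewrite nth_iota // add0n => /pw_span.
Qed.

(** The family [psi] stands for a polynomial; of being polynomial only the
    naturality is retained. A linear dependence between the powers of [a] reads
    [a^N = a^(N+1) t(a)], and [(a t(a))^(N+1)] is the idempotent. *)
Lemma fitting X (a : mor X X) :
  exists psi : forall Y : C, mor Y Y -> mor Y Y,
  [/\ forall Y Z (g : mor Y Z) b c, g \oc b = c \oc g ->
         g \oc psi Y b = psi Z c \oc g,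
      (a \oc psi X a) \oc (a \oc psi X a) = a \oc psi X a
    & exists N, pw a N.+1 \oc (a \oc psi X a) = pw a N.+1].
Proof.
have [N [c aN]] := pw_dependent a.
pose t Y (b : mor Y Y) := b \oc pev c b.
have tnat Y Z (g : mor Y Z) b b' : g \oc b = b' \oc g ->
    g \oc t Y b = t Z b' \oc g.
  by move=> gb; rewrite /t mcompA gb -!mcompA (pev_nat _ gb).
exists (fun Y b => pev c b \oc pw (t Y b) N).
have E : a \oc (pev c a \oc pw (t X a) N) = pw (t X a) N.+1.
  by rewrite mcompA.
have aNt : pw a N.+1 \oc t X a = pw a N.+1.
  by rewrite /t mcompA -pwSr -[pw a N.+2]/(a \oc pw a N.+1) -mcompA -aN.
have aNtj j : pw a N.+1 \oc pw (t X a) j = pw a N.+1.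
  elim: j => [|j IH]; first by rewrite mcompm1.
  by rewrite -[pw (t X a) j.+1]/(t X a \oc pw (t X a) j) mcompA aNt.
have cm : pev c a \oc a = a \oc pev c a by apply/esym/pev_nat.
have ta : pw (t X a) N.+1 = pw (pev c a) N.+1 \oc pw a N.+1 by apply: pwM.
rewrite E; split.
- move=> Y Z g b b' gb; rewrite mcompA (pev_nat _ gb) -!mcompA.
  by rewrite (pw_nat _ (tnat _ _ _ _ _ gb)).
- by rewrite {1}ta -mcompA aNtj -ta.
- by exists N; apply: aNtj.
Qed.

(** Take the idempotent of [fitting]. Naturality carries it along [g] to
    [e \oc psi e], which [e] absorbs, and transporting its equation
    [a^(N+1) \oc eps = a^(N+1)] along [g] gives [e \oc g]. *)
Lemma fitting_idem X (a : mor X X) : exists eps : mor X X,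
  [/\ eps \oc eps = eps,
      forall Y (g : mor X Y) e, e \oc e = e -> g \oc a = e \oc g ->
        g \oc eps = e \oc g
    & forall Y (g : mor Y X) e, e \oc e = e -> a \oc g = g \oc e ->
        eps \oc g = g \oc e].
Proof.
have [psi [nat ee [N aN]]] := fitting a; exists (a \oc psi X a).
have pwe Y (e : mor Y Y) n : e \oc e = e -> pw e n.+1 = e.
  move=> eidem; elim: n => [|n IH]; first exact: mcompm1.
  by rewrite -[pw e n.+2]/(e \oc pw e n.+1) IH.
split=> // Y g e eidem ga.
  have gphi : g \oc (a \oc psi X a) = (e \oc psi Y e) \oc g.
    by rewrite mcompA ga -!mcompA (nat _ _ _ _ _ ga).
  have := congr1 (mcomp g) aN.
  rewrite mcompA (pw_nat _ ga) (pwe _ _ _ eidem) -mcompA gphi.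
  by rewrite !mcompA eidem.
have gphi : (a \oc psi X a) \oc g = g \oc (e \oc psi Y e).
  rewrite -mcompA -(nat _ _ g e a) // mcompA ga -mcompA //.
have eps_a : pw a N.+1 \oc (a \oc psi X a) = (a \oc psi X a) \oc pw a N.+1.
  apply/esym/pw_nat; rewrite -mcompA; congr (_ \oc _).
  by apply/esym/nat.
have := congr1 (mcomp^~ g) aN; rewrite eps_a -mcompA.
rewrite -(pw_nat (a := e) (e := a)) // (pwe _ _ _ eidem) mcompA gphi.
have ce : e \oc psi Y e = psi Y e \oc e by apply: nat.
by rewrite -!mcompA -ce (mcompA e) eidem.
Qed.

(** The geometric series. *)
Lemma nilpotent_unip X (a : mor X X) n : pw a n = 0 -> is_iso (idmor X - a).
Proof.
move=> an; pose s := \sum_(i < n) pw a i; exists s.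
have tel m : (idmor X - a) \oc \sum_(i < m) pw a i = idmor X - pw a m.
  elim: m => [|m IH]; first by rewrite big_ord0 comp0r subrr.
  rewrite big_ord_recr /= compDr IH compBl mcomp1m addrA subrK //.
have sa : s \oc a = a \oc s.
  rewrite comp_suml comp_sumr; apply: eq_bigr => i _.
  by rewrite -pwSr.
have := tel n; rewrite an subr0 -/s => e; split=> //.
by rewrite -[RHS]e [LHS]compBr [RHS]compBl mcomp1m mcompm1 sa.
Qed.

End Fitting.

Section Splitting.
Variables (k : fieldType) (C : triCat k).
Implicit Types X Y Z A B K U : C.
Notation S := (shift C).

Definition karoubi X := forall e : mor X X, e \oc e = e ->
  exists Y (s : mor Y X) (r : mor X Y), r \oc s = idmor Y /\ s \oc r = e.

(** A retraction of the map [f] onto [f'] extends to a retraction of cones: the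
    composite of the two induced maps is unipotent, hence can be corrected. *)
Lemma cone_retract K U X K' U' X' (f : mor K U) (g : mor U X)
    (h : mor X (S K)) (f' : mor K' U') (g' : mor U' X') (h' : mor X' (S K'))
    (s1 : mor K' K) (r1 : mor K K') (s2 : mor U' U) (r2 : mor U U') :
  dist f g h -> dist f' g' h' -> r1 \oc s1 = idmor K' -> r2 \oc s2 = idmor U' ->
  s2 \oc f' = f \oc s1 -> r2 \oc f = f' \oc r1 ->
  exists (j : mor X' X) (r : mor X X'),
  [/\ r \oc j = idmor X', j \oc g' = g \oc s2, fmap S s1 \oc h' = h \oc j,
      r \oc g = g' \oc r2 & fmap S r1 \oc h = h' \oc r].
Proof.
move=> t t' rs1 rs2 sf rf.
have [j [jg hj]] := TR3 t' t sf; have [r [rg hr]] := TR3 t t' rf.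
have mg : r \oc j \oc g' = g' by rewrite -mcompA jg mcompA rg -mcompA rs2 mcompm1.
have hm : h' \oc (r \oc j) = h'.
  by rewrite mcompA -hr -mcompA -hj mcompA -fmapM rs1 fmap1 mcomp1m.
have [|w [wm _ wE]] := @unipotent_inv _ _ _ (r \oc j).
  apply: (dist_sq0 (dist_rot t')); first by rewrite compBl mg mcomp1m subrr.
  by rewrite compBr hm mcompm1 subrr.
exists j, (w \oc r); split=> //; first by rewrite -mcompA.
  by rewrite -mcompA rg mcompA wE !compBl mg mcomp1m subrr subr0.
by rewrite mcompA wE !compBr hm mcompm1 subrr subr0.
Qed.

(** The orthogonality makes [U -> X] functorial in [X], so an idempotent of [X]
    extends to one of the whole triangle; the cone of the map between its images
    on [K] and [U] splits the idempotent of [X]. *)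
Lemma karoubi_cone K U X (f : mor K U) (g : mor U X) (h : mor X (S K)) :
  dist f g h -> hz 1 U K -> karoubi K -> karoubi U -> karoubi X.
Proof.
move=> t oUK kK kU e ee.
have [|a0 ga0] := dist_lift (u := e \oc g) (dist_rot t); first exact: oUK.
have [a [aa /(_ _ _ _ ee (esym ga0)) ga _]] := fitting_idem a0.
have [|c0 [c0h c0f]] := TR3 (a := a) (b := e) (dist_rot t) (dist_rot t).
  exact: esym.
have fc0 : fmap S f \oc c0 = fmap S a \oc fmap S f.
  by move: c0f; rewrite compNr compNl => /oppr_inj.
have saa : fmap S a \oc fmap S a = fmap S a by rewrite -fmapM aa.
have [c [cc /(_ _ _ _ saa fc0) fc /(_ _ _ _ ee c0h) ch]] := fitting_idem c0.
have [b cE] := autoeq_full c; rewrite -{}cE in cc fc ch.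
have bb : b \oc b = b by apply: (autoeq_faithful (E := S)); rewrite fmapM.
have fb : f \oc b = a \oc f by apply: (autoeq_faithful (E := S)); rewrite !fmapM.
have [K' [s1 [r1 [rs1 sr1]]]] := kK b bb.
have [U' [s2 [r2 [rs2 sr2]]]] := kU a aa.
have bs1 : b \oc s1 = s1 by rewrite -sr1 -mcompA rs1 mcompm1.
have as2 : a \oc s2 = s2 by rewrite -sr2 -mcompA rs2 mcompm1.
have r2a : r2 \oc a = r2 by rewrite -sr2 mcompA rs2 mcomp1m.
pose f' := r2 \oc f \oc s1; have [X' [g' [h' t']]] := TR1_cone f'.
have [||j [r [_ jg hj rg hr]]] := cone_retract t t' rs1 rs2.
- by rewrite !mcompA sr2 -fb -mcompA bs1.
- by rewrite /f' -!mcompA sr1 fb mcompA r2a.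
pose m := r \oc e \oc j.
have mg : m \oc g' = g'.
  by rewrite -!mcompA jg (mcompA e) -ga -(mcompA g) as2 mcompA rg -mcompA rs2
     mcompm1.
have hm : h' \oc m = h'.
  rewrite !mcompA -hr -!mcompA (mcompA h) -ch -mcompA -hj.
  by rewrite !mcompA -!fmapM -mcompA bs1 rs1 fmap1 mcomp1m.
have [|w [wm mw wE]] := @unipotent_inv _ _ _ m.
  apply: (dist_sq0 (dist_rot t')).
    by rewrite compBl mg mcomp1m subrr.
  by rewrite compBr hm mcompm1 subrr.
have wg : w \oc g' = g' by rewrite wE !compBl mg mcomp1m subrr subr0.
have hw : h' \oc w = h' by rewrite wE !compBr hm mcompm1 subrr subr0.
have rs : (w \oc r \oc e) \oc (e \oc j) = idmor X'.
  by rewrite -!mcompA (mcompA e e) ee -wm /m -!mcompA.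
exists X', (e \oc j), (w \oc r \oc e); split=> //.
set e' := e \oc j \oc _.
have ee' : e \oc e' = e' by rewrite /e' !mcompA ee.
have e'e : e' \oc e = e' by rewrite /e' -!mcompA ee.
have e'e' : e' \oc e' = e' by rewrite /e' mcompA -(mcompA (e \oc j)) rs mcompm1.
have dg : (e - e') \oc g = 0.
  rewrite compBl /e' -!mcompA -ga (mcompA r g) rg -(mcompA g' r2) r2a.
  by rewrite (mcompA w) wg (mcompA j) jg -mcompA sr2 (mcompA e) -ga
     -mcompA aa subrr.
have hd : h \oc (e - e') = 0.
  rewrite compBr /e' !mcompA -ch -(mcompA _ h j) -hj mcompA -fmapM bs1.
  rewrite -(mcompA _ h' w) hw -(mcompA _ h' r) -hr mcompA -fmapM sr1.
  by rewrite -mcompA -ch mcompA -fmapM bb subrr.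
have := dist_sq0 (dist_rot t) dg hd.
rewrite compBl !compBr ee ee' e'e e'e' subrr subr0 => /eqP.
by rewrite subr_eq0 => /eqP.
Qed.

End Splitting.

(** * Krull-Schmidt decompositions *)

Section KrullSchmidt.
Variables (k : fieldType) (C : triCat k).
Implicit Types X Y Z A B K U : C.
Notation dimE X := (\dim {: mor X X}).

Lemma dsum2_dim A B X : is_dsum2 A B X -> ~ is_zero A -> (dimE B < dimE X)%N.
Proof.
move=> [i1 [i2 [p1 [p2 [h1 h2 h3 h4 _]]]]] nzA.
pose L := (linfun (@postcomp k C X B X i2) \o
           linfun (@precomp k C X B B p2))%VF.
have LE f : L f = i2 \oc (f \oc p2) by rewrite !lfunE /= !lfunE.
have kL : lker L = 0%VS.
  apply/eqP; rewrite -subv0; apply/subvP => f; rewrite memv_ker memv0 LE.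
  move=> /eqP /(congr1 (fun g => p2 \oc g \oc i2)).
  by rewrite !mcompA h2 mcomp1m -mcompA h2 mcompm1 comp0r comp0l => ->.
have dL : \dim (limg L) = dimE B by rewrite limg_dim_eq // kL capv0.
rewrite -dL ltn_neqAle dimvS ?subvf // andbT.
have [le ->] := dimv_leqif_eq (subvf (limg L)).
apply/negP => /eqP full; apply/nzA/is_zeroP.
have /memv_imgP[f _] : idmor X \in limg L by rewrite full memvf.
rewrite LE => /(congr1 (fun g => p1 \oc g \oc i1)).
by rewrite mcompm1 h1 !mcompA h4 !comp0l.
Qed.

Lemma karoubi_compl X (e : mor X X) :
  (exists Y (s : mor Y X) (r : mor X Y), r \oc s = idmor Y /\
     s \oc r = idmor X - e) ->
  exists Y (s : mor Y X) (r : mor X Y), r \oc s = idmor Y /\ s \oc r = e.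
Proof.
move=> [Y [s [r [rs sr]]]]; have [Z [j [p [pj _ _ e1]]]] := retract_complement rs.
exists Z, j, p; split=> //.
have -> : j \oc p = idmor X - s \oc r by rewrite -e1 addrAC subrr add0r.
by rewrite sr subKr.
Qed.

(** An idempotent that is invertible on a summand [A] splits off a copy of [A],
    and what remains is an idempotent on the smaller complement of that copy. *)
Lemma karoubi_step A X (e : mor X X) (i : mor A X) (p : mor X A) :
  e \oc e = e -> is_iso (p \oc e \oc i) -> ~ is_zero A ->
  (forall B, retract B X -> (dimE B < dimE X)%N -> karoubi B) ->
  exists Y (s : mor Y X) (r : mor X Y), r \oc s = idmor Y /\ s \oc r = e.
Proof.
move=> ee [u [upei _]] nzA IH; pose s := e \oc i; pose r := u \oc p \oc e.
have rs : r \oc s = idmor A.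
  by rewrite /r /s -!mcompA (mcompA e e) ee -upei -!mcompA.
have es : e \oc s = s by rewrite /s mcompA ee.
have re : r \oc e = r by rewrite /r -mcompA ee.
clearbody s r.
have [Z [j [q [qj qs rj e1]]]] := retract_complement rs.
have dZ : is_dsum2 A Z X by exists s, j, r, q.
have kZ := IH Z (dsum2_retractr dZ) (dsum2_dim dZ nzA).
pose e' := q \oc e \oc j.
have ej : e \oc j = j \oc e'.
  rewrite -[LHS]mcomp1m -e1 compDl -!mcompA (mcompA r e) re rj comp0r add0r.
  by rewrite /e' -mcompA.
have e'e' : e' \oc e' = e'.
  by rewrite {1}/e' -mcompA -ej mcompA -(mcompA q e e) ee.
clearbody e'.
have eE : e = s \oc r + j \oc e' \oc q.
  by rewrite -[LHS]mcompm1 -e1 compDr !mcompA es ej.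
have [Z' [s' [r' [rs' sr']]]] := kZ _ e'e'.
have [T [i1 [i2 [p1 [p2 [h1 h2 h3 h4 hT]]]]]] := has_dsum2 A Z'.
exists T, (s \oc p1 + j \oc s' \oc p2), (i1 \oc r + i2 \oc r' \oc q).
split.
  rewrite compDl !compDr !mcompA -!(mcompA _ r s) -!(mcompA _ q s).
  rewrite -!(mcompA _ r j) -!(mcompA _ q j) rs qs rj qj !comp0r !comp0l.
  by rewrite !mcompm1 addr0 add0r -(mcompA i2) rs' mcompm1.
rewrite compDl !compDr !mcompA -!(mcompA _ p1) -!(mcompA _ p2) h1 h2 h3 h4.
by rewrite !comp0r !comp0l !mcompm1 addr0 add0r -(mcompA j) sr' -eE.
Qed.

(** On a local summand of [X], either [e] or [1 - e] is invertible, and it is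
    enough to split one of them. *)
Lemma karoubi_krull_schmidt (P : C -> Prop) : add_closed P ->
  krull_schmidt P -> forall X, P X -> karoubi X.
Proof.
move=> [_ _ Pr] ks X; move: {2}(dimE X).+1 (ltnSn (dimE X)) => n.
elim: n X => // n IH X Xn PX e ee; rewrite ltnS in Xn.
have {}IH B : retract B X -> (dimE B < dimE X)%N -> karoubi B.
  by move=> rB dB; apply: IH (leq_trans dB Xn) (Pr _ _ rB PX).
have [[|m] [F [PF [inj [proj [h1 _ h3]]]]]] := ks X PX.
  rewrite big_ord0 in h3; exists X, 0, 0.
  by rewrite comp0l h3 -(mcomp1m e) -h3 comp0l.
have [_ [ne loc]] := PF ord0.
have nz : ~ is_zero (F ord0) by move/is_zeroP.
case: (loc (proj ord0 \oc e \oc inj ord0)) => iso.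
  exact: karoubi_step ee iso nz IH.
apply/karoubi_compl/(karoubi_step (i := inj ord0) (p := proj ord0) _ _ nz IH).
  by rewrite compBl !compBr !mcomp1m mcompm1 ee subrr subr0.
by rewrite compBr mcompm1 compBl h1.
Qed.

(** An endomorphism [f] with neither [f] nor [1 - f] invertible has a Fitting
    idempotent different from zero and one. *)
Lemma karoubi_trichotomy X : karoubi X ->
  [\/ is_zero X, local_end X
    | exists A B, [/\ is_dsum2 A B X, ~ is_zero A & ~ is_zero B]].
Proof.
move=> kX; case: (classic (is_zero X)) => z; first by constructor 1.
case: (classic (local_end X)) => l; first by constructor 2.
constructor 3; have [f nf] : exists f : mor X X,
    ~ (is_iso f \/ is_iso (idmor X - f)).
  apply: NNPP => nl; apply: l; split=> [i0|f]; first exact/z/is_zeroP.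
  by apply: NNPP => nf; apply: nl; exists f.
have [psi [nat ee [N fN]]] := fitting f.
have [A [s [r [rs sr]]]] := kX _ ee.
have [B [j [p [pj ps rj e1]]]] := retract_complement rs.
exists A, B; split; first by exists s, j, r, p.
- move/is_zeroP => a0; apply: nf; right; apply: (nilpotent_unip (n := N.+1)).
  by rewrite -fN -sr -(mcompm1 s) a0 comp0r comp0l comp0r.
- move/is_zeroP => b0; apply: nf; left; exists (psi X f).
  have fpsi : f \oc psi X f = idmor X.
    by rewrite -sr -e1 -(mcompm1 j) b0 comp0r comp0l addr0.
  by split=> //; rewrite -fpsi; apply/esym/nat.
Qed.

Lemma karoubi_indecomposable (P : C -> Prop) X :
  (forall Y Z, retract Y Z -> P Z -> P Y) -> karoubi X ->
  indecomposable_in P X -> local_end X.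
Proof.
move=> Pr /karoubi_trichotomy kX [PX nz ind].
case: kX => [/nz []|//|[A [B [dAB nA nB]]]].
have PA := Pr _ _ (dsum2_retractl dAB) PX.
have PB := Pr _ _ (dsum2_retractr dAB) PX.
by case: (ind _ _ PA PB dAB).
Qed.

Lemma karoubi_dsum_local : (forall X, karoubi X) -> forall X,
  exists n (F : 'I_n -> C), (forall i, local_end (F i)) /\ is_dsum F X.
Proof.
move=> kC X; move: {2}(dimE X).+1 (ltnSn (dimE X)) => n.
elim: n X => // n IH X Xn; rewrite ltnS in Xn.
have [z|l|[A [B [dAB nA nB]]]] := karoubi_trichotomy (kC X).
- by exists 0%N, (fun _ => X); split=> [[]|] //; apply: dsum_nil.
- by exists 1%N, (fun _ => X); split=> //; apply: dsum_one.
have [n1 [F1 [l1 d1]]] := IH A (leq_trans (dsum2_dim (dsum2_sym dAB) nB) Xn).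
have [n2 [F2 [l2 d2]]] := IH B (leq_trans (dsum2_dim dAB nA) Xn).
exists (n1 + n2)%N, (fun i : 'I_(n1 + n2) =>
  match split i with inl a => F1 a | inr b => F2 b end).
by split; [move=> i; case: (split i) | apply: dsum_cat d1 d2 dAB].
Qed.

Lemma dsum_retract n (F : 'I_n -> C) X i : is_dsum F X -> retract (F i) X.
Proof. by move=> [inj [proj [h _ _]]]; exists (inj i), (proj i). Qed.

Lemma karoubi_ks (P : C -> Prop) : (forall X, karoubi X) ->
  (forall Y Z, retract Y Z -> P Z -> P Y) -> krull_schmidt P.
Proof.
move=> kC Pr X PX; have [n [F [l dF]]] := karoubi_dsum_local kC X.
by exists n, F; split=> // i; split=> //; apply: Pr (dsum_retract i dF) PX.
Qed.

Section ClusterTilting.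
Variables (d : nat) (P : C -> Prop).
Hypothesis (d_gt0 : (0 < d)%N) (ctP : ctilt d P).

Lemma rfilt_hz n X U i : rfilt P n X -> P U -> (0 < i)%N -> (i + n < d)%N ->
  hz i U X.
Proof.
move=> fX PU; elim: fX i => {n X} [X PX|n K V X f g h PV _ IH t] i i0 id.
  by apply: (ctilt_rigid ctP); rewrite // i0 -[i]addn0.
apply: (hz_dist3r t); last by apply: IH; rewrite // addSn -addnS.
by apply: (ctilt_rigid ctP); rewrite // i0 (leq_ltn_trans _ id) ?leq_addr.
Qed.

(** Idempotents split on [P], and [karoubi_cone] climbs the filtration of an
    object by shifts of [P]. *)
Lemma ctilt_karoubi : krull_schmidt P -> forall X, karoubi X.
Proof.
move=> ks; have kP := karoubi_krull_schmidt (ctilt_closed ctP) ks.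
move=> X; have fX := ctilt_rfilt d_gt0 ctP X.
have: (d.-1 < d)%N by rewrite prednK.
elim: fX => {X} [X PX _|n K U X f g h PU fK IH t nd]; first exact: kP.
apply: karoubi_cone t _ (IH (ltnW nd)) (kP _ PU).
exact: rfilt_hz fK PU _ _.
Qed.

End ClusterTilting.

End KrullSchmidt.

(** * Periodic and transient objects *)

Section Orbits.
Variables (k : fieldType) (C : triCat k) (E : autoeq C).
Implicit Types X Y Z A B N : C.
Notation S := (shift C).

Definition periodic X := exists2 p, (0 < p)%N & isomorphic (iter p E X) X.

Lemma iter_isomorphic n X Y : isomorphic (iter n E X) (iter n E Y) <-> isomorphic X Y.
Proof.
elim: n => //= n IH; apply: iff_trans IH; exact: autoeq_isomorphic.
Qed.

Lemma iter_bwd n X : isomorphic (iter n (bwd E) (iter n E X)) X.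
Proof.
by rewrite -iterE_bwd -(iterE_obj n E); apply: autoeq_bwd_fwd.
Qed.

Lemma iter_fwd n X : isomorphic (iter n E (iter n (bwd E) X)) X.
Proof.
by rewrite -iterE_bwd -(iterE_obj n E); apply: autoeq_fwd_bwd.
Qed.

Lemma iter_retract n X Y : retract X Y -> retract (iter n E X) (iter n E Y).
Proof. by rewrite -!iterE_obj; apply: functor_retract. Qed.

Lemma powE_pos n X : powE E (Posz n) X = iter n E X.
Proof. exact: iterE_obj. Qed.

Lemma powE_neg n X : powE E (Negz n) X = iter n.+1 (bwd E) X.
Proof. exact: (iterE_obj n.+1 (autoeq_op E)). Qed.

Lemma powE_bwd i X : bwd (powE E i) X = powE E (- i) X.
Proof.
case: i => [[|n]|n]; first by [].
  by rewrite -NegzE powE_neg iterE_bwd.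
by rewrite [LHS](iterE_bwd n.+1 (autoeq_op E)) NegzE opprK powE_pos.
Qed.

Lemma powES i X : isomorphic (powE E (i + 1) X) (E (powE E i X)).
Proof.
case: i => n; first by rewrite -PoszD addn1 !powE_pos; apply: isomorphic_refl.
rewrite powE_neg; case: n => [|n].
  by apply/isomorphic_sym; apply: autoeq_fwd_bwd.
have -> : Negz n.+1 + 1 = Negz n.
  by rewrite !NegzE -[n.+2]addn1 PoszD opprD subrK.
by rewrite powE_neg; apply/isomorphic_sym; apply: autoeq_fwd_bwd.
Qed.

Lemma powED i n X : isomorphic (powE E (i + n%:Z) X) (iter n E (powE E i X)).
Proof.
elim: n => [|n IH]; first by rewrite addr0; apply: isomorphic_refl.
rewrite -addn1 PoszD addrA addn1 /=; apply: isomorphic_trans (powES _ _) _.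
exact: functor_isomorphic.
Qed.

Lemma orbit_repeat (i j : int) X : i != j ->
  isomorphic (powE E i X) (powE E j X) -> periodic X.
Proof.
wlog ij : i j / (i < j)%R.
  move=> wl; rewrite neq_lt => /orP[] ij e; first by apply: (wl i j); rewrite ?lt_eqF.
  by apply: (wl j i); rewrite ?lt_eqF //; apply: isomorphic_sym.
move=> _ e; have [m m0 mE] : exists2 m, (0 < m)%N & j = i + m%:Z.
  exists `|j - i|%N; first by rewrite absz_gt0 subr_eq0 gt_eqF.
  by rewrite gez0_abs ?subr_ge0 ?(ltW ij) // addrCA subrr addr0.
exists m => //; have {mE}e : isomorphic (iter m E (powE E i X)) (powE E i X).
  apply: isomorphic_sym; apply: isomorphic_trans e _; rewrite mE.
  exact: powED.
case: i e {ij} => n; rewrite ?powE_pos ?powE_neg => e.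
  by apply/(iter_isomorphic n); rewrite -iterD addnC iterD.
move/(iter_isomorphic n.+1): e; rewrite -iterD addnC iterD => e.
have f := iter_fwd n.+1 X.
apply: isomorphic_trans (isomorphic_trans e f).
by apply/iter_isomorphic/isomorphic_sym.
Qed.

Lemma periodic_iter p X m : isomorphic (iter p E X) X ->
  isomorphic (iter (m * p) E X) X.
Proof.
move=> e; elim: m => [|m IH]; first exact: isomorphic_refl.
rewrite mulSn addnC iterD; apply: isomorphic_trans IH.
exact/iter_isomorphic.
Qed.

Lemma periodic_orbit p X i : (0 < p)%N -> isomorphic (iter p E X) X ->
  exists2 r, (r < p)%N & isomorphic (powE E i X) (iter r E X).
Proof.
move=> p0 e.
have pos n : exists2 r, (r < p)%N & isomorphic (iter n E X) (iter r E X).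
  exists (n %% p)%N; first by rewrite ltn_mod.
  rewrite {1}(divn_eq n p) addnC iterD.
  exact/iter_isomorphic/periodic_iter.
case: i => n; first by rewrite powE_pos; apply: pos.
have [r rp er] := pos (n.+1 * p.-1)%N; exists r => //.
rewrite powE_neg; apply: isomorphic_trans er.
have := periodic_iter n.+1 e; rewrite -{1}(prednK p0) mulnS iterD => e'.
apply: isomorphic_trans (iter_bwd n.+1 _); apply: isomorphic_sym.
by rewrite -!(iterE_bwd n.+1); apply/bwd_isomorphic.
Qed.

Lemma orth_powEl i X Y : orth X (powE E i Y) <-> orth (powE E (- i) X) Y.
Proof. by rewrite -powE_bwd; apply: iff_sym; apply: orth_adjl. Qed.

Lemma orth_powEr i X Y : orth (powE E i X) Y <-> orth X (powE E (- i) Y).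
Proof. by rewrite -powE_bwd; apply: orth_adjr. Qed.

(** The translates are those of the test object [A], not of [N]; this makes the
    closure under triangles in [N] immediate although [E] need not be exact. *)
Definition transient N := forall A, exists L : seq int, forall i, i \notin L ->
  orth N (powE E i A) /\ orth (powE E i A) N.

Lemma transient_dist A B Z (f : mor A B) (g : mor B Z) (h : mor Z (S A)) :
  dist f g h -> transient A -> transient Z -> transient B.
Proof.
move=> t tA tZ X; have [L LA] := tA X; have [M MZ] := tZ X.
exists (L ++ M) => i; rewrite mem_cat negb_or => /andP[/LA[a1 a2] /MZ[z1 z2]].
by split; [apply: orth_distl t a1 z1 | apply: orth_distr t a2 z2].
Qed.

Lemma transient_closed : add_closed transient.
Proof.
split=> [Z z|A B X dX tA tB|X Y rX tY] W.
- by exists [::] => i _; split; [apply: orth0l | apply: orth0r].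
- have [L LA] := tA W; have [M MB] := tB W.
  exists (L ++ M) => i; rewrite mem_cat negb_or => /andP[/LA[a1 a2] /MB[b1 b2]].
  by split; [apply: orth_dsum2l dX a1 b1 | apply: orth_dsum2r dX a2 b2].
have [L LY] := tY W; exists L => i /LY[o1 o2].
by split; [apply: orth_retract rX (retract_refl _) o1
         | apply: orth_retract (retract_refl _) rX o2].
Qed.

(** Some translate of [X] outside the exceptional list of [X] is isomorphic to
    [X]. *)
Lemma periodic_transient X N : periodic X -> transient N ->
  orth X N /\ orth N X.
Proof.
move=> [p p0 e] tN; have [L LN] := tN X.
(* Multiples of the period eventually leave the list. *)
have [m mL] : exists m, forall n, (m <= n)%N -> Posz n \notin L.
  elim: (L) => [|i l [m IH]]; first by exists 0%N.
  exists (maxn m `|i|%N.+1) => n; rewrite geq_max => /andP[/IH nl ni].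
  rewrite inE negb_or nl andbT; apply/eqP => ei.
  by rewrite -ei absz_nat ltnn in ni.
have [] := LN (Posz (m * p)%N); first by apply: mL; rewrite leq_pmulr.
have ei := periodic_iter m e; rewrite powE_pos.
by move=> /(orth_isor _ ei) o1 /(orth_isol _ ei) o2.
Qed.

Hypothesis cE : hz_compat E.

Lemma hz_pow_op i n X Y : hz n (bwd (powE E i) X) Y <-> hz n X (powE E i Y).
Proof. exact: (hz_compat_op (hz_compat_pow i cE)). Qed.

(** Thanks to [hz_compat], shifting [A] before or after applying the power of
    [E] makes no difference. *)
Lemma hz_pow_shiftr i N A : hz 0 N (powE E i (S A)) <-> hz 1 N (powE E i A).
Proof.
apply: iff_trans (iff_sym (hz_pow_op _ _ _ _)) _.
apply: iff_trans (hz_shiftr _ _ _) _; exact: hz_pow_op.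
Qed.

Lemma hz_pow_shiftl i N A : hz 1 (powE E i (S A)) N <-> hz 0 (powE E i A) N.
Proof.
have c := hz_compat_pow i cE.
apply: iff_trans (c _ _ _) _; apply: iff_trans (hz_shiftl _ _ _) _.
exact: iff_sym (c _ _ _).
Qed.

Lemma transient_shift N : transient N -> transient (S N).
Proof.
move=> tN A; have [L LN] := tN (bwd S A); exists L => i /LN[o1 o2].
have e : isomorphic (powE E i (S (bwd S A))) (powE E i A).
  exact/functor_isomorphic/autoeq_fwd_bwd.
split.
  by apply/(orth_isor _ e)/hz_pow_shiftr/hz_shiftl.
by apply/(orth_isol _ e)/(hz_pow_shiftl i N).
Qed.

Lemma transient_unshift N : transient N -> transient (bwd S N).
Proof.
move=> tN A; have [L LN] := tN (S A); exists L => i /LN[o1 o2]; split.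
  by apply/(hz_unshiftl 0)/hz_pow_shiftr.
apply/(hz_pow_shiftl i (bwd S N))/(hz_shiftr 0).
exact/(orth_isor _ (autoeq_fwd_bwd S N)).
Qed.

End Orbits.

(** * Splitting off transient summands *)

Section Decomposition.
Variables (k : fieldType) (C : triCat k) (E : autoeq C).
Hypothesis cE : hz_compat E.
Implicit Types X Y Z A B K U N W : C.
Notation S := (shift C).
Notation transient := (transient E).

(** The mixed composites vanish automatically. *)
Lemma dsum2_of3 A B X (i1 : mor A X) (i2 : mor B X) (p1 : mor X A)
    (p2 : mor X B) :
  p1 \oc i1 = idmor A -> p2 \oc i2 = idmor B ->
  i1 \oc p1 + i2 \oc p2 = idmor X -> is_dsum2 A B X.
Proof.
move=> h1 h2 e; exists i1, i2, p1, p2; split=> //.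
  have := congr1 (fun u => p2 \oc u \oc i1) e.
  rewrite mcompm1 compDr compDl !mcompA h2 mcomp1m -mcompA h1 mcompm1.
  by move/(canRL (addrK _)) => ->; rewrite subrr.
have := congr1 (fun u => p1 \oc u \oc i2) e.
rewrite mcompm1 compDr compDl !mcompA h1 mcomp1m -(mcompA _ p2) h2 mcompm1.
by move/(canRL (addrK _)) => ->; rewrite subrr.
Qed.

Lemma dsum2_shuffle A1 A2 B1 B2 A B P N X :
  is_dsum2 A1 A2 A -> is_dsum2 B1 B2 B -> is_dsum2 A B X ->
  is_dsum2 A1 B1 P -> is_dsum2 A2 B2 N -> is_dsum2 P N X.
Proof.
move=> [a1 [a2 [a3 [a4 [ea1 ea2 _ _ ea]]]]] [b1 [b2 [b3 [b4 [eb1 eb2 _ _ eb]]]]].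
move=> [i [j [p [q [ip jq iq jp ex]]]]].
move=> [u1 [u2 [u3 [u4 [eu1 eu2 eu3 eu4 eu]]]]].
move=> [v1 [v2 [v3 [v4 [ev1 ev2 ev3 ev4 ev]]]]].
have cross A' B' P' (x1 : mor A' A) (x3 : mor A A') (y1 : mor B' B)
    (y3 : mor B B') (w1 : mor A' P') (w2 : mor B' P') (w3 : mor P' A')
    (w4 : mor P' B') : x3 \oc x1 = idmor A' -> y3 \oc y1 = idmor B' ->
    w1 \oc w3 + w2 \oc w4 = idmor P' ->
    (w1 \oc x3 \oc p + w2 \oc y3 \oc q) \oc
      (i \oc x1 \oc w3 + j \oc y1 \oc w4) = idmor P'.
  move=> ex1 ey1 ew; rewrite compDl !compDr !mcompA.
  rewrite -!(mcompA _ p i) -!(mcompA _ q i) -!(mcompA _ p j) -!(mcompA _ q j).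
  rewrite ip jq iq jp !mcompm1 !comp0r !comp0l addr0 add0r.
  by rewrite -(mcompA w1) -(mcompA w2) ex1 ey1 !mcompm1.
apply: (dsum2_of3 (cross _ _ _ _ _ _ _ _ _ _ _ ea1 eb1 eu)
                  (cross _ _ _ _ _ _ _ _ _ _ _ ea2 eb2 ev)).
rewrite !compDl !compDr !mcompA.
rewrite -!(mcompA _ u3 u1) -!(mcompA _ u3 u2) -!(mcompA _ u4 u1).
rewrite -!(mcompA _ u4 u2) -!(mcompA _ v3 v1) -!(mcompA _ v3 v2).
rewrite -!(mcompA _ v4 v1) -!(mcompA _ v4 v2).
rewrite eu1 eu2 eu3 eu4 ev1 ev2 ev3 ev4 !mcompm1 !comp0r !comp0l.
rewrite !addr0 !add0r addrACA -!compDl -!(mcompA i) -!(mcompA j) -!compDr.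
by rewrite ea eb !mcompm1.
Qed.

Lemma karoubi_ind (Q : C -> Prop) : (forall X, karoubi X) ->
  (forall Z, is_zero Z -> Q Z) -> (forall X, local_end X -> Q X) ->
  (forall A B X, is_dsum2 A B X -> Q A -> Q B -> Q X) -> forall X, Q X.
Proof.
move=> kC Q0 Ql QD X.
move: {2}(\dim {: mor X X}).+1 (ltnSn (\dim {: mor X X})) => n.
elim: n X => // n IH X Xn; rewrite ltnS in Xn.
have [z|l|[A [B [dAB nA nB]]]] := karoubi_trichotomy (kC X).
- exact: Q0.
- exact: Ql.
apply: (QD _ _ _ dAB); apply: IH.
  exact: leq_trans (dsum2_dim (dsum2_sym dAB) nB) Xn.
exact: leq_trans (dsum2_dim dAB nA) Xn.
Qed.

Variable Pp : C -> Prop.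
Hypothesis Pp_orth : forall X N, Pp X -> transient N -> orth X N /\ orth N X.

Lemma rfilt_orth n X N : rfilt Pp n X -> transient N -> orth X N /\ orth N X.
Proof.
move=> fX; elim: fX N => {n X} [X PX|n K U X f g h PU _ IH t] N tN.
  exact: Pp_orth.
have [uN Nu] := Pp_orth PU tN.
have [kN _] := IH _ (transient_unshift cE tN).
have [_ Nk] := IH _ (transient_unshift cE tN).
split.
  by apply: orth_distl (dist_rot t) uN _; apply/orth_adjr.
by apply: orth_distr (dist_rot t) Nu _; apply/orth_adjl.
Qed.

Definition splits_off n X := exists XP XN,
  [/\ is_dsum2 XP XN X, rfilt Pp n XP & transient XN].

(** By orthogonality [f] is diagonal for the two decompositions. The cones of
    its components are retracts of [X], and the sum of the two projections is
    the identity up to a map of square zero. *)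
Lemma splits_off_cone n K U X (f : mor K U) (g : mor U X) (h : mor X (S K)) :
  dist f g h -> splits_off n K ->
  (exists UP UN, [/\ is_dsum2 UP UN U, Pp UP & transient UN]) ->
  splits_off n.+1 X.
Proof.
move=> t [KP [KN [[iP [iN [pP [pN [ip in_ _ _ eK]]]]] fKP tKN]]].
move=> [UP [UN [[jP [jN [qP [qN [jq jqN _ _ eU]]]]] PUP tUN]]].
have [o1 _] := rfilt_orth fKP tUN.
have [_ o2] := Pp_orth PUP tKN.
pose fP := qP \oc f \oc iP; pose fN := qN \oc f \oc iN.
have sP : jP \oc fP = f \oc iP.
  rewrite -[RHS]mcomp1m -eU compDl -!mcompA [qN \oc _]o1 comp0r addr0.
  by rewrite /fP -!mcompA.
have sN : jN \oc fN = f \oc iN.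
  rewrite -[RHS]mcomp1m -eU compDl -!mcompA [qP \oc _]o2 comp0r add0r.
  by rewrite /fN -!mcompA.
have rP : qP \oc f = fP \oc pP.
  rewrite -[LHS]mcompm1 -eK compDr !mcompA [qP \oc _ \oc iN]o2 comp0l addr0 //.
have rN : qN \oc f = fN \oc pN.
  rewrite -[LHS]mcompm1 -eK compDr !mcompA [qN \oc _ \oc iP]o1 comp0l add0r //.
have [XP [gP [hP tP]]] := TR1_cone fP; have [XN [gN [hN tN]]] := TR1_cone fN.
have fXP : rfilt Pp n.+1 XP := rfiltS PUP fKP tP.
have tXN : transient XN.
  exact: transient_dist (dist_rot tN) tUN (transient_shift cE tKN).
have [oPN oNP] := rfilt_orth fXP tXN.
have [aP [bP [ba ag ha bg hb]]] := cone_retract t tP ip jq sP rP.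
have [aN [bN [ba' ag' ha' bg' hb']]] := cone_retract t tN in_ jqN sN rN.
pose u := aP \oc bP + aN \oc bN.
have ug : u \oc g = g.
  rewrite compDl -!mcompA bg bg' !mcompA ag ag' -!mcompA -compDr eU mcompm1 //.
have hu : h \oc u = h.
  rewrite compDr !mcompA -ha -ha' -!mcompA -hb -hb' !mcompA -!fmapM -compDl.
  by rewrite -autoeqD eK fmap1 mcomp1m.
have [|w [wu uw wE]] := @unipotent_inv _ _ _ u.
  apply: (dist_sq0 (dist_rot t)); first by rewrite compBl ug mcomp1m subrr.
  by rewrite compBr hu mcompm1 subrr.
have uP : u \oc aP = aP.
  by rewrite compDl -!mcompA ba (oPN (bN \oc aP)) comp0r addr0 mcompm1.
have uN : u \oc aN = aN.
  by rewrite compDl -!mcompA ba' (oNP (bP \oc aN)) comp0r add0r mcompm1.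
exists XP, XN; split=> //.
apply: (@dsum2_of3 _ _ _ aP aN (bP \oc w) (bN \oc w)).
- by rewrite -mcompA wE !compBl uP mcomp1m subrr subr0.
- by rewrite -mcompA wE !compBl uN mcomp1m subrr subr0.
- by rewrite !mcompA -compDl.
Qed.

Lemma rfilt_splits_off (Q : C -> Prop) n X :
  (forall U, Q U ->
     exists UP UN, [/\ is_dsum2 UP UN U, Pp UP & transient UN]) ->
  rfilt Q n X -> splits_off n X.
Proof.
move=> dec; elim=> {n X} [X /dec[XP [XN [dX PX tX]]]|n K U X f g h QU _ IH t].
  by exists XP, XN; split=> //; apply: rfilt0.
exact: splits_off_cone t IH (dec _ QU).
Qed.

End Decomposition.

(** * Local boundedness *)

Section LocalSummands.
Variables (k : fieldType) (C : triCat k).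
Implicit Types X Y Z A B W : C.

Lemma local_addcl (G : C -> Prop) B X : local_end B -> addcl G X ->
  retract B X -> exists2 Y, G Y & retract B Y.
Proof.
move=> [ne loc]; move: X; apply: addcl_min => [|X GX rBX]; last by exists X.
split=> [Z z [s [r rs]]|A1 A2 X dX IH1 IH2 [s [r rs]]|X Y rXY IH rBX].
- by case: ne; rewrite -rs (orth0r z s) comp0r.
- have [i1 [i2 [p1 [p2 [_ _ _ _ e]]]]] := dX.
  have {}e : r \oc i1 \oc (p1 \oc s) + r \oc i2 \oc (p2 \oc s) = idmor B.
    by rewrite -rs -[s in RHS]mcomp1m -e compDl compDr !mcompA.
  case: (loc (r \oc i1 \oc (p1 \oc s))) => iso.
    by apply: IH1; apply: iso_factor_retract iso.
  apply: IH2; apply: iso_factor_retract (r \oc i2) _.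
  by rewrite (_ : _ \oc _ = idmor B - r \oc i1 \oc (p1 \oc s)) // -e addrC addKr.
- exact/IH/(retract_trans rBX).
Qed.

Lemma dim_orth X Y : \dim {: mor X Y} = 0%N <-> orth X Y.
Proof.
split=> [/eqP|o].
  rewrite dimv_eq0 => /eqP f0 f; apply/eqP; rewrite -memv0 -f0; exact: memvf.
apply/eqP; rewrite dimv_eq0 -subv0; apply/subvP => f _.
by rewrite (o f) mem0v.
Qed.

Lemma dim_injective (V W : vectType k) (f : 'Hom(V, W)) :
  (forall v, f v = 0 -> v = 0) -> (\dim {: V} <= \dim {: W})%N.
Proof.
move=> inj; suff <- : \dim (limg f) = \dim {: V} by rewrite dimvS ?subvf.
rewrite limg_dim_eq //; apply/eqP; rewrite -subv0; apply/subvP => v.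
by rewrite memv_cap memv_ker memv0 => /andP[_ /eqP/inj ->].
Qed.

(** The terms of the sum in [locally_bounded]. *)
Definition biweight A B := (\dim {: mor B A} + \dim {: mor A B})%N.

Lemma biweight_retract A B W : retract B W -> (biweight A B <= biweight A W)%N.
Proof.
move=> [s [r rs]]; apply: leq_add.
  apply: (dim_injective (f := linfun (@precomp k C W B A r))) => v.
  rewrite lfunE /= => /(congr1 (fun u => u \oc s)).
  by rewrite /precomp -mcompA rs mcompm1 comp0l.
apply: (dim_injective (f := linfun (@postcomp k C A B W s))) => v.
rewrite lfunE /= => /(congr1 (mcomp r)).
by rewrite /postcomp mcompA rs mcomp1m comp0r.
Qed.

Lemma biweight0 A B : biweight A B = 0%N <-> orth B A /\ orth A B.
Proof.
rewrite -!dim_orth; split=> [/eqP|[a b]]; last by rewrite /biweight a b.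
by rewrite addn_eq0 => /andP[/eqP -> /eqP ->].
Qed.

(** Each entry of [L] accounts for at most one of the pairwise non-isomorphic
    [B i]. *)
Lemma biweight_sum A n (B : 'I_n -> C) (L : list C) (P : pred 'I_n) :
  (forall i j, i != j -> ~ isomorphic (B i) (B j)) ->
  (forall i, P i -> biweight A (B i) = 0%N \/
     exists2 W, List.In W L & isomorphic (B i) W) ->
  (\sum_(i | P i) biweight A (B i) <= sumn (map (biweight A) L))%N.
Proof.
move=> niso; elim: L P => [|W L IH] P PL /=.
  by rewrite big1 // => i /PL[//|[W []]].
have [[i0 [Pi0 e0]]|none] :=
    classic (exists i0, P i0 /\ isomorphic (B i0) W).
  rewrite (bigD1 i0) //=; apply: leq_add.
    exact/biweight_retract/isomorphic_retract.
  apply: IH => i /andP[Pi ii0]; case: (PL i Pi); first by left.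
  case=> W' [<-|W'L] e; last by right; exists W'.
  case: (niso _ _ ii0); apply: isomorphic_trans e _; exact: isomorphic_sym.
apply: leq_trans (leq_addl _ _); apply: IH => i Pi.
case: (PL i Pi) => [|[W' [e|W'L] eW]]; first by left.
  by case: none; exists i; rewrite e.
by right; exists W'.
Qed.

End LocalSummands.

(** Otherwise one could lengthen duplicate-free lists forever. *)
Lemma bounded_finite (T : eqType) (bad : T -> Prop) N :
  (forall s : seq T, uniq s -> (forall x, x \in s -> bad x) -> (size s <= N)%N) ->
  exists s : seq T, forall x, bad x -> x \in s.
Proof.
move=> bd; apply: NNPP => nfin.
have grow n : exists s : seq T,
    [/\ uniq s, forall x, x \in s -> bad x & size s = n].
  elim: n => [|n [s [us sb ss]]]; first by exists [::].
  have [x [bx xs]] : exists x, bad x /\ x \notin s.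
    apply: NNPP => no; apply: nfin; exists s => x bx.
    by apply: contraT => xs; case: no; exists x.
  exists (x :: s); split=> [|y|]; rewrite /= ?xs ?ss //.
  by rewrite inE => /predU1P[-> //|]; apply: sb.
have [s [us sb ss]] := grow N.+1.
by have := bd s us sb; rewrite ss ltnn.
Qed.

Lemma mem_In (T : eqType) (x : T) s : x \in s -> List.In x s.
Proof.
elim: s => //= y s IH; rewrite inE => /predU1P[->|/IH]; by [left | right].
Qed.

Lemma fin_list_union (A : Type) (G : A -> Prop) n (Q : 'I_n -> list A -> Prop) :
  (forall i (L M : list A), (forall x, List.In x L -> List.In x M) ->
     Q i L -> Q i M) ->
  (forall i, exists L, (forall x, List.In x L -> G x) /\ Q i L) ->
  exists L, (forall x, List.In x L -> G x) /\ forall i, Q i L.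
Proof.
elim: n Q => [|n IH] Q mono ex; first by exists [::]; split=> [x []|[]].
have [|i|L [LG QL]] := IH (fun i => Q (lift ord0 i)); first by move=> i; apply: mono.
  exact: ex.
have [M [MG QM]] := ex ord0; exists (L ++ M)%list; split=> [x|i].
  by move=> xLM; case: (List.in_app_or _ _ _ xLM) => [/LG|/MG].
by case: (unliftP ord0 i) => [j ->|->]; [apply: mono (QL j) | apply: mono QM];
  move=> x xL; apply/List.in_or_app; [left | right].
Qed.

Section LocallyBounded.
Variables (k : fieldType) (C : triCat k) (nu : serreFunctor C) (d : nat).
Hypothesis d_gt0 : (0 < d)%N.
Implicit Types X Y Z A B W N T : C.
Let E := nudE nu d.
Let cE : hz_compat E := hz_compat_nud nu d.
Notation transient := (transient E).
Notation periodic := (periodic E).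

Variable U : C -> Prop.
Hypotheses (ctU : ctilt d U) (lbU : locally_bounded U).

Lemma lfilt_perp n X V i : lfilt U n X -> U V -> (0 < i)%N -> (i + n < d)%N ->
  hz i X V.
Proof.
move=> fX UV; elim: fX i => {n X} [X UX|n X Y K f g h UY _ IH t] i i0 id.
  by apply: (ctilt_rigid ctU); rewrite // i0 -[i]addn0.
apply: (hz_dist1l t); last by apply: IH; rewrite // addSn -addnS.
by apply: (ctilt_rigid ctU); rewrite // i0 (leq_ltn_trans _ id) ?leq_addr.
Qed.

Lemma U_powE i X : U X -> U (powE E i X).
Proof. by move=> UX; rewrite powE_nud; apply: ctilt_nud_pow. Qed.

Lemma local_powE i X : local_end X -> local_end (powE E i X).
Proof. exact: local_fwd. Qed.

(** If the orbit of [X] is infinite then its members are pairwise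
    non-isomorphic, and local boundedness applies to them. *)
Lemma local_bounded_orbit X A : U X -> local_end X -> ~ periodic X -> U A ->
  exists s : seq int, forall i, i \notin s ->
    orth (powE E i X) A /\ orth A (powE E i X).
Proof.
move=> UX lX nper UA; have [_ lb] := lbU; have [N NA] := lb A UA.
pose bad i := ~ (orth (powE E i X) A /\ orth A (powE E i X)).
have [s us sb|s sP] := @bounded_finite _ bad N.
  have le := NA (size s) (fun i : 'I_(size s) => powE E (nth 0 s i) X).
  apply: leq_trans (le _ _).
  - rewrite -[X in (X <= _)%N]card_ord -sum1_card; apply: leq_sum => i _.
    rewrite lt0n; apply/eqP => /biweight0 o.
    by apply: (sb (nth 0 s i)) => //; apply: mem_nth.
  - by move=> i; apply: local_indec; [apply: local_powE | apply: U_powE].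
  - move=> i j ij e; apply: nper; apply: orbit_repeat e.
    by rewrite nth_uniq.
exists s => i si; apply: NNPP => /sP.
by rewrite (negbTE si).
Qed.

(** For maps out of [U] only the first layer of the filtration of [A] counts,
    the others being positive shifts of [U]. *)
Lemma rfilt_cover A : exists2 V, U V &
  forall Y, U Y -> orth Y V -> orth Y A.
Proof.
have dd : (d.-1 < d)%N by rewrite prednK.
case: (ctilt_rfilt d_gt0 ctU A) dd => {A} [A UA|n K V A f g h UV fK t] nd.
  by exists A.
exists V => // Y UY o; apply: orth_distr (dist_rot t) o _.
exact: (rfilt_hz ctU fK UY (i := 1)).
Qed.

Lemma lfilt_cover A : exists2 V, U V &
  forall Y, U Y -> orth V Y -> orth A Y.
Proof.
have dd : (d.-1 < d)%N by rewrite prednK.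
case: (ctilt_lfilt d_gt0 ctU A) dd => {A} [A UA|n A V K f g h UV fK t] nd.
  by exists A.
exists V => // Y UY o; apply: (hz_dist1l t (n := 0)) => //.
exact: lfilt_perp fK UY _ _.
Qed.

Lemma local_transient X : U X -> local_end X -> ~ periodic X -> transient X.
Proof.
move=> UX lX nper A; have bd := local_bounded_orbit UX lX nper.
have [V1 UV1 c1] := rfilt_cover A; have [V2 UV2 c2] := lfilt_cover A.
have [s1 b1] := bd V1 UV1; have [s2 b2] := bd V2 UV2.
(* [transient] moves the test object, hence the change of sign. *)
exists (map (fun i => - i) (s1 ++ s2)) => i.
rewrite -[i in i \notin _]opprK mem_map; last exact: oppr_inj.
rewrite mem_cat negb_or => /andP[/b1[o1 _] /b2[_ o2]].
split; first by apply/orth_powEl/c1 => //; apply: U_powE.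
by apply/orth_powEr/c2 => //; apply: U_powE.
Qed.

Let kC : forall X, karoubi X := ctilt_karoubi d_gt0 ctU (proj1 lbU).

Variable V : C -> Prop.
Hypotheses (Vc : add_closed V)
  (V_rigid : forall X Y i, V X -> V Y -> (0 < i < d)%N -> hz i X Y)
  (V_pow : forall i X, V X -> V (powE E i X))
  (U_cogen : forall Q, U Q -> exists2 W, V W & cogen d W Q).

(** The exponents are negative so that [periodic_of_add] can move them over to
    the controlled object. *)
Definition cogen_orbit (Wp : C * nat) X :=
  forall j, cogen d (iter (j * Wp.2) (bwd E) Wp.1) X.

(** These are the two properties of periodic objects of [U] that will be used;
    unlike periodicity itself they pass to finite sums at once. *)
Definition periodic_type X :=
  (exists Wp, [/\ V Wp.1, (0 < Wp.2)%N & cogen_orbit Wp X]) /\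
  forall N, transient N -> orth X N /\ orth N X.

Lemma iter_bwd_retract n X Y :
  retract X Y -> retract (iter n (bwd E) X) (iter n (bwd E) Y).
Proof. exact: (iter_retract (autoeq_op E)). Qed.

Lemma cogen_orbit_join Wp Wp' : V Wp.1 -> V Wp'.1 ->
  (0 < Wp.2)%N -> (0 < Wp'.2)%N -> exists Wp'', [/\ V Wp''.1, (0 < Wp''.2)%N,
    forall X, cogen_orbit Wp X -> cogen_orbit Wp'' X
  & forall X, cogen_orbit Wp' X -> cogen_orbit Wp'' X].
Proof.
case: Wp Wp' => [W p] [W' p'] /= VW VW' p0 p0'; have [W'' dW] := has_dsum2 W W'.
have [_ VD _] := Vc; exists (W'', (p * p')%N) => /=; split=> [||X c j|X c j].
- exact: VD dW VW VW'.
- by rewrite muln_gt0 p0.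
- have := c (j * p')%N => /=; rewrite mulnAC -mulnA.
  apply: cogen_retractl; apply: iter_bwd_retract.
  exact: dsum2_retractl dW.
- have := c (j * p)%N => /=; rewrite -mulnA.
  apply: cogen_retractl; apply: iter_bwd_retract.
  exact: dsum2_retractr dW.
Qed.

(** If [W] controls [X] then a translate of [W] controls the same translate of
    [X], and that one is isomorphic to [X] when taken along a period. *)
Lemma periodic_type_local X : U X -> periodic X -> periodic_type X.
Proof.
move=> UX perX; split; last by move=> N; apply: periodic_transient.
have [p p0 e] := perX; have [W VW cW] := U_cogen UX.
exists (W, p); split=> // j /=; set n := (j * p)%N.
have {e}e : isomorphic X (iter n (bwd E) X).
  apply: isomorphic_trans (isomorphic_sym (iter_bwd E n X)) _.
  apply/(iter_isomorphic (autoeq_op E))/periodic_iter/e.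
have [_ _ cr] := cogen_closed d (iter n (bwd E) W).
apply: cr (isomorphic_retract e) _.
rewrite -!(iterE_obj n (autoeq_op E)); apply: cogen_transport cW.
exact/hz_compat_iter/hz_compat_op.
Qed.

Lemma dsum2_zero_r X Z : is_zero Z -> is_dsum2 X Z X.
Proof.
move=> /is_zeroP z; apply: (@dsum2_of3 _ _ _ _ _ (idmor X) 0 (idmor X) 0).
- by rewrite mcomp1m.
- by rewrite comp0l z.
- by rewrite mcomp1m comp0l addr0.
Qed.

Lemma U_splits X : U X -> exists XP XN,
  [/\ is_dsum2 XP XN X, periodic_type XP & transient XN].
Proof.
have [V0 VD Vr] := Vc; have [T0 TD Tr] := transient_closed E.
have [Z0 z0] := has_zero C.
have pZ Z : is_zero Z -> periodic_type Z.
  move=> z; split; last by move=> N _; split; [apply: orth0l | apply: orth0r].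
  exists (Z, 1%N); split=> //; first exact: V0.
  by move=> j; have [c0 _ _] := cogen_closed d (iter (j * 1) (bwd E) Z); apply: c0.
move: X; apply: (karoubi_ind kC) => [X z|X l|A B X dX IA IB] UX.
- by exists X, Z0; split; [apply: dsum2_zero_r | apply: pZ | apply: T0].
- have [per|nper] := classic (periodic X).
    exists X, Z0; split; [exact: dsum2_zero_r | | exact: T0].
    exact: periodic_type_local.
  exists Z0, X; split; [exact/dsum2_sym/dsum2_zero_r | exact: pZ |].
  exact: local_transient.
have [_ _ Ur] := ctilt_closed ctU.
have [|A1 [A2 [dA [[Wp [VW p0 cA]] oA] tA]]] := IA.
  exact: Ur (dsum2_retractl dX) UX.
have [|B1 [B2 [dB [[Wp' [VW' p0' cB]] oB] tB]]] := IB.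
  exact: Ur (dsum2_retractr dX) UX.
have [P dP] := has_dsum2 A1 B1; have [N dN] := has_dsum2 A2 B2.
exists P, N; split; [exact: dsum2_shuffle dA dB dX dP dN | | exact: TD dN tA tB].
split.
  have [Wp'' [VW'' p0'' cl cr]] := cogen_orbit_join VW VW' p0 p0'.
  exists Wp''; split=> // j; have [_ cD _] := cogen_closed d
    (iter (j * Wp''.2) (bwd E) Wp''.1).
  by apply: cD dP _ _; [apply: cl | apply: cr].
move=> M tM; have [a1 a2] := oA M tM; have [b1 b2] := oB M tM.
by split; [apply: orth_dsum2l dP a1 b1 | apply: orth_dsum2r dP a2 b2].
Qed.

(** Pigeonhole on the finitely many local summands of [W]. *)
Lemma periodic_of_add T W p : local_end T -> (0 < p)%N ->
  (forall j, retract (iter (j * p) E T) W) -> periodic T.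
Proof.
move=> lT p0 rT; have [n [F [lF dF]]] := karoubi_dsum_local kC W.
have lTj j : local_end (iter (j * p) E T).
  by rewrite -iterE_obj; apply: local_fwd.
have isoF j : exists b, isomorphic (iter (j * p) E T) (F b).
  have aW : addcl (fun Y => exists b, Y = F b) W.
    apply: add_closed_dsum (addcl_closed _) dF _ => b.
    by apply: addcl_sub; exists b.
  have [_ [b ->] r] := local_addcl (lTj j) aW (rT j).
  by exists b; apply: local_retract_iso.
have [f fP] := @fin_all_exists 'I_n.+1 (fun=> 'I_n)
  (fun j b => isomorphic (iter (j * p) E T) (F b)) (fun j => isoF j).
have [j [j' [jj' e]]] : exists j j', j != j' /\ f j = f j'.
  apply: NNPP => no; have /leq_card : injective f.
    by move=> j j' e; apply: contraTeq isT => jj'; case: no; exists j, j'.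
  by rewrite !card_ord ltnn.
apply: (@orbit_repeat _ _ _ (Posz (j * p)) (Posz (j' * p))).
  by rewrite eqz_nat eqn_pmul2r.
rewrite !powE_pos; apply: isomorphic_trans (fP j) _; rewrite e.
exact/isomorphic_sym/fP.
Qed.

(** In the periodic case [T] is a retract of [XP], which is controlled by every
    backward translate of [W] along the period; so [T] is in the additive
    closure of all of these, and forward translates of [T] are in that of [W]. *)
Lemma V_local_dichotomy T : V T -> local_end T -> periodic T \/ transient T.
Proof.
move=> VT lT; have Tc := transient_closed E.
have Porth X N : periodic_type X -> transient N -> orth X N /\ orth N X.
  by move=> [_]; apply.
have [XP [XN [dT fP tN]]] :=
  rfilt_splits_off cE Porth U_splits (ctilt_rfilt d_gt0 ctU T).
have [i1 [i2 [p1 [p2 [h1 h2 h3 h4 e]]]]] := dT.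
have ee : (i1 \oc p1) \oc (i1 \oc p1) = i1 \oc p1.
  by rewrite mcompA -(mcompA i1) h1 mcompm1.
have [e1|e0] := local_idem lT ee; last first.
  right; have [_ _ Tr] := Tc; apply: Tr tN; exists p2, i2.
  by rewrite -e e0 add0r.
have rT : retract T XP by exists p1, i1.
left; have [||[[W p] /= [VW p0]] fW] := rfilt_collect
    (I := {Wp : C * nat | V Wp.1 /\ (0 < Wp.2)%N})
    (R := fun Wp => cogen_orbit (sval Wp)) _ _ fP.
- move=> [Wp [VW p0]] [Wp' [VW' p0']].
  have [Wp'' [VW'' p0'' cl cr]] := cogen_orbit_join VW VW' p0 p0'.
  by exists (exist _ Wp'' (conj VW'' p0'')).
- by move=> X [[Wp [VW p0 cX]] _]; exists (exist _ Wp (conj VW p0)).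
have {}fW : rfilt (cogen_orbit (W, p)) d.-1 XP := fW.
apply: (periodic_of_add (W := W) lT p0) => j; set n := (j * p)%N.
have Wn : iter n (bwd E) W = powE E (- n%:Z) W by rewrite -powE_bwd iterE_bwd.
have VWn : V (iter n (bwd E) W) by rewrite Wn; apply: V_pow.
have fWn : rfilt (cogen d (iter n (bwd E) W)) d.-1 XP.
  by apply: rfilt_mono fW => Y; apply.
have aT : addcl (fun Y => Y = iter n (bwd E) W) T.
  apply: (add_of_perp d_gt0 _ _ _ rT fWn) => i; apply: V_rigid => //.
have [_ -> r] := local_addcl lT aT (retract_refl T).
apply: retract_trans (iter_retract E n r) _.
exact/isomorphic_retract/iter_fwd.
Qed.

Lemma finite_orbit T A : V T -> local_end T -> exists L : list C,
  (forall Y, List.In Y L -> exists i, Y = powE E i T) /\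
  forall i, orth (powE E i T) A /\ orth A (powE E i T) \/
    exists2 Y, List.In Y L & isomorphic (powE E i T) Y.
Proof.
move=> VT lT; have [[p p0 e]|tT] := V_local_dichotomy VT lT.
  exists (List.map (fun r => powE E (Posz r) T) (iota 0 p)); split.
    by move=> Y /List.in_map_iff[r [<- _]]; exists (Posz r).
  move=> i; right; have [r rp er] := periodic_orbit i p0 e.
  exists (iter r E T) => //; rewrite -powE_pos.
  apply/List.in_map_iff; exists r; split=> //.
  by apply: mem_In; rewrite mem_iota.
have [s sP] := tT A; exists (List.map (fun i => powE E (- i) T) s); split.
  by move=> Y /List.in_map_iff[i [<- _]]; exists (- i).
move=> i; have [si|/sP[o1 o2]] := boolP (- i \in s).
  right; exists (powE E i T); last exact: isomorphic_refl.
  apply/List.in_map_iff; exists (- i); rewrite opprK; split=> //.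
  exact: mem_In.
left; split; first by apply/orth_powEr.
by apply/orth_powEl.
Qed.

Lemma finite_orbits n (F : 'I_n -> C) A :
  (forall a, V (F a) /\ local_end (F a)) -> exists L : list C,
  (forall Y, List.In Y L -> exists a i, Y = powE E i (F a)) /\
  forall a i, orth (powE E i (F a)) A /\ orth A (powE E i (F a)) \/
    exists2 Y, List.In Y L & isomorphic (powE E i (F a)) Y.
Proof.
move=> VF; apply: fin_list_union => [a L M LM QL i|a].
  by case: (QL i) => [|[Y /LM YM e]]; [left | right; exists Y].
have [VFa lFa] := VF a; have [L [LG LA]] := finite_orbit A VFa lFa.
by exists L; split=> // Y /LG[i ->]; exists a, i.
Qed.

Section Generator.
Variable T : C.
Hypotheses (VT : V T)
  (V_gen : forall X, V X <-> addcl (fun Y => exists i, Y = powE E i T) X).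

Let local_parts : exists n (F : 'I_n -> C),
  (forall a, V (F a) /\ local_end (F a)) /\
  forall X, V X <-> addcl (fun Y => exists a i, Y = powE E i (F a)) X.
Proof.
have [n [F [lF dF]]] := karoubi_dsum_local kC T.
have [_ _ Vr] := Vc; exists n, F.
have VF a : V (F a) by apply: Vr VT; apply: dsum_retract dF.
split=> // X; split; last first.
  by apply: addcl_min => // _ [a [i ->]]; apply: V_pow.
move=> /V_gen; apply: addcl_min X; first exact: addcl_closed.
move=> _ [i ->]; set G := addcl _; have [G0 GD Gr] : add_closed G.
  exact: addcl_closed.
apply: (add_closed_dsum (Q := fun X => G (powE E i X)) _ dF) => [|a].
  split=> [Z z|A B S dS|X Y rX].
  - by apply: G0; apply: zero_fwd.
  - by apply: GD; apply: functor_dsum2 dS; apply: autoeq_additive.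
  - by apply: Gr; apply: functor_retract.
by apply: addcl_sub; exists a, i.
Qed.

Lemma V_functorially_finite : functorially_finite V.
Proof.
have [n [F [VF VG]]] := local_parts.
apply: functorially_finite_ext (fun X => iff_sym (VG X)) _.
apply: addcl_functorially_finite => A.
have [L [LG LA]] := finite_orbits A VF; exists L; split=> // _ [a [i ->]].
exact: LA.
Qed.

Lemma V_locally_bounded : locally_bounded V.
Proof.
have [_ _ Vr] := Vc; split; first exact: karoubi_ks kC Vr.
have [n [F [VF VG]]] := local_parts.
move=> A VA; have [L [_ LA]] := finite_orbits A VF.
exists (sumn (map (biweight A) L)) => m B indB niso.
apply: (biweight_sum (P := xpredT)) => // b _.
have lB := karoubi_indecomposable Vr (@kC (B b)) (indB b).
have [VB _ _] := indB b; have /VG aB := VB.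
have [_ [a [i ->]] r] := local_addcl lB aB (retract_refl _).
have {r}e : isomorphic (B b) (powE E i (F a)).
  by apply: local_retract_iso r; rewrite //; apply: local_powE; case: (VF a).
case: (LA a i) => [[o1 o2]|[Y YL eY]].
  left; apply/biweight0; split; first exact/(orth_isol _ e).
  exact/(orth_isor _ e).
by right; exists Y => //; apply: isomorphic_trans e eY.
Qed.

End Generator.

End LocallyBounded.

(** * Transfer of cluster tilting along the functor *)

Theorem proposition4p15 (k : fieldType) (d : nat) (hd : (1 <= d)%N)
    (C D : triCat k) (nuC : serreFunctor C) (nuD : serreFunctor D)
    (pi : functor D C)
    (pi_tri : triangle_functor pi)
    (pi_nu : commutes_with_serre nuD nuC pi)
    (pi_rigid : preserves_rigidity d pi)
    (U : D -> Prop) (hU : ctilt d U) (hpiU : ctilt d (image_add pi U)) :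
  (has_additive_generator (image_add pi U) ->
     forall V : D -> Prop, ctilt d V ->
       ctilt d (image_add pi V) /\ has_additive_generator (image_add pi V))
  /\
  (locally_bounded (image_add pi U) ->
   has_nud_additive_generator nuC d (image_add pi U) ->
     forall V : D -> Prop, ctilt d V ->
       [/\ ctilt d (image_add pi V),
           locally_bounded (image_add pi V)
         & has_nud_additive_generator nuC d (image_add pi V)]).
Proof.
have gen V (ctV : ctilt d V) := image_cogen hd pi_tri ctV.
split=> [[M [UM Mgen]] V ctV|lb [M [UM Mgen]] V ctV].
  have [W VW cW] := gen V ctV U M UM.
  pose G := addcl (fun Y : C => Y = W).
  have Gc : add_closed G by apply: addcl_closed.
  have GV Q : G Q -> image_add pi V Q.
    by apply: addcl_min (addcl_closed _) _ Q => _ ->.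
  have UG Q : image_add pi U Q -> exists2 W', G W' & cogen d W' Q.
    move=> /Mgen; apply: addcl_min (cogen_exists_closed d Gc) _ Q => _ ->.
    by exists W => //; apply: addcl_sub.
  have VG := image_generated hd pi_tri pi_nu pi_rigid ctV hpiU Gc GV UG.
  split; last by exists W.
  apply: (image_ctilt hd pi_tri pi_nu pi_rigid ctV hpiU (gen V ctV U)).
  apply: functorially_finite_ext (fun X => iff_sym (VG X)) _.
  apply: addcl_functorially_finite => X; exists [:: W].
  split=> [W' [<-|[]] //|_ ->]; right; exists W; first by left.
  exact: isomorphic_refl.
have [T VT cT] := gen V ctV U M UM.
have Vpow := image_powE pi_tri pi_nu ctV.
pose G := addcl (fun Y => exists i : int, Y = nud_pow nuC d i T).
have Gc : add_closed G by apply: addcl_closed.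
have GV Q : G Q -> image_add pi V Q.
  apply: addcl_min (addcl_closed _) _ Q => _ [i ->].
  by rewrite -powE_nud; apply: Vpow.
have UG Q : image_add pi U Q -> exists2 W', G W' & cogen d W' Q.
  move=> /Mgen; apply: addcl_min (cogen_exists_closed d Gc) _ Q => _ [i ->].
  exists (nud_pow nuC d i T); first by apply: addcl_sub; exists i.
  rewrite -!powE_nud; apply: cogen_transport cT.
  exact/hz_compat_pow/hz_compat_nud.
have VG := image_generated hd pi_tri pi_nu pi_rigid ctV hpiU Gc GV UG.
have Vgen X : image_add pi V X <->
    addcl (fun Y => exists i, Y = powE (nudE nuC d) i T) X.
  apply: iff_trans (VG X) _.
  by split; apply: addcl_mono => _ [i ->]; exists i; rewrite powE_nud.
have Vc : add_closed (image_add pi V) by apply: addcl_closed.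
have Vrig := image_rigid pi_rigid ctV.
split; last by exists T.
  apply: (image_ctilt hd pi_tri pi_nu pi_rigid ctV hpiU (gen V ctV U)).
  exact: (V_functorially_finite hd hpiU lb Vc Vrig Vpow (gen V ctV U) VT Vgen).
exact: (V_locally_bounded hd hpiU lb Vc Vrig Vpow (gen V ctV U) VT Vgen).
Qed.
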